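(* Let $r$ be the number of indices $i\in\{1,\dots,g\}$ such that $b_i$ is a root of unity, and assume that the $2g$ numbers $b_1^{\pm1},\dots,b_g^{\pm1}$ are distinct. Then: (1) only finitely many partial quotients $a_n$ of $\sqrt{D(t)}$ have degree $\ge r+2$; (2) suppose (after renumbering) that the roots of unity among the $b_i$ are exactly $b_1,\dots,b_r$, and let $D_p(t)=(t^2-1)(t-\rho_1)^2\cdots(t-\rho_r)^2$. Then $\sqrt{D(t)}$ has only finitely many partial quotients $a_n$ of degree $\ge d-r$, with the exception of the partial quotients $a_n$ for those indices $n$ such that the convergent $(p_n(t),q_n(t))$ of $\sqrt{D(t)}$ is of the form $\big(p(t)(t-\rho_{r+1})\cdots(t-\rho_g),\,q(t)\big)$, where $(p(t),q(t))$ is a convergent of $\sqrt{D_p(t)}$.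
   Context: Let $g\ge1$, let $\rho_1,\dots,\rho_g\in\mathbb C$ be distinct with $\rho_i\neq\pm1$, let $D_1(t)=\prod_{i=1}^g(t-\rho_i)$ and $D(t)=(t^2-1)D_1(t)^2$, a polynomial of degree $2d$ with $d=g+1$. Fix square roots $\sqrt{\rho_i^2-1}$ and put $b_i=\rho_i+\sqrt{\rho_i^2-1}$ (so $b_i^{-1}=\rho_i-\sqrt{\rho_i^2-1}$). For a monic polynomial $E(t)$ of even degree $2e$ which is not a square, $\sqrt{E(t)}$ denotes the element of $\mathbb C((t^{-1}))$ with leading term $t^{e}$ whose square is $E$. Its continued fraction expansion is defined by $\alpha_0=\sqrt{E}$, $a_n=\lfloor\alpha_n\rfloor$ (the polynomial part, i.e. the sum of the terms with nonnegative exponent), $\alpha_{n+1}=(\alpha_n-a_n)^{-1}$; the $a_n\in\mathbb C[t]$ are the partial quotients. Set $p_0=1$, $p_1=a_0$, $p_{n+1}=a_np_n+p_{n-1}$ and $q_0=0$, $q_1=1$, $q_{n+1}=a_nq_n+q_{n-1}$ for $n\ge1$; the pairs $(p_n,q_n)$ are the convergents.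
   Formalization: In (2), ''(p,q) is a convergent of √D_p'' is read up to a common nonzero constant factor; with the pairs normalized exactly by the recurrence the claim fails, e.g. for ρ = (0, 1/2, 2). *)

(* Defs.v *)
From HB Require Import structures.
From mathcomp Require Import all_boot all_order all_algebra.
From mathcomp Require Import boolp classical_sets functions cardinality fsbigop.
From mathcomp Require Import reals complex zify.

Set Implicit Arguments.
Unset Strict Implicit.
Unset Printing Implicit Defensive.

Import Order.TTheory GRing.Theory Num.Theory.
Local Open Scope classical_set_scope.
Local Open Scope ring_scope.

(* K((t^-1)): [lcoef f n] is the coefficient of t^n. *)
Record laurent (K : fieldType) := Laurent {
  lcoef : int -> K ;
  lcoef_bounded : exists N : int, forall n : int, N < n -> lcoef n = 0
}.

HB.instance Definition _ (K : fieldType) := gen_eqMixin (laurent K).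
HB.instance Definition _ (K : fieldType) := gen_choiceMixin (laurent K).

Section LaurentRing.
Variable K : fieldType.
Implicit Types (f g h : laurent K) (N M P n : int).

Lemma laurentP f g : lcoef f =1 lcoef g -> f = g.
Proof.
case: f => f Pf; case: g => g Pg /= /funext fg.
by case: _ / fg Pg => Pg; congr Laurent; apply: Prop_irrelevance.
Qed.

Definition lbounded N (u : int -> K) := forall n, N < n -> u n = 0.

Definition lconv (u v : int -> K) (n : int) : K :=
  \sum_(i \in [set: int]) u i * v (n - i).

Lemma lconvE N M u v (m : nat) : lbounded N u -> lbounded M v ->
  lconv u v (N + M - m%:Z) =
  \sum_(i < m.+1) u (N - i%:Z) * v (M - (m - i)%N%:Z).
Proof.
move=> Nu Mv; rewrite /lconv (fsbigE [seq N - k%:Z | k <- iota 0 m.+1]) //.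
- rewrite big_mkcond big_map.
  have -> : iota 0 m.+1 = index_iota 0 m.+1 by rewrite /index_iota subn0.
  rewrite big_mkord; apply: eq_bigr => i _; rewrite in_setT.
  by congr (_ * v _); have := ltn_ord i; lia.
- by rewrite map_inj_uniq ?iota_uniq // => x y; lia.
- move=> i _ Ni.
  have [/Nu -> | iN] := ltP N i; first by rewrite mul0r.
  have [/Mv -> | iM] := ltP M (N + M - m%:Z - i); first by rewrite mulr0.
  case/negP: Ni.
  apply/mapP; exists (absz (N - i)); last by lia.
  by rewrite mem_iota; lia.
Qed.

Lemma lconv_bounded N M u v : lbounded N u -> lbounded M v ->
  lbounded (N + M) (lconv u v).
Proof.
move=> Nu Mv n ltn; apply: fsbig1 => i _.
have [/Nu -> | iN] := ltP N i; first by rewrite mul0r.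
by rewrite (Mv (n - i)) ?mulr0 //; lia.
Qed.

Lemma lboundedW N M u : N <= M -> lbounded N u -> lbounded M u.
Proof. by move=> NM Nu n Mn; apply: Nu; apply: le_lt_trans Mn. Qed.

Definition ltrunc N (u : int -> K) (m : nat) : {poly K} :=
  \poly_(i < m.+1) u (N - i%:Z).

Lemma lconv_poly N M u v (m : nat) : lbounded N u -> lbounded M v ->
  lconv u v (N + M - m%:Z) = (ltrunc N u m * ltrunc M v m)`_m.
Proof.
move=> Nu Mv; rewrite (lconvE m Nu Mv) coefM; apply: eq_bigr => i _.
by rewrite !coef_poly ltn_ord ltnS leq_subr.
Qed.

Lemma lconvC u v : (exists N, lbounded N u) -> (exists N, lbounded N v) ->
  lconv u v = lconv v u.
Proof.
move=> [N Nu] [M Mv]; apply/funext => n.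
have [lt|le] := ltP (N + M) n.
  by rewrite (lconv_bounded Nu Mv) // (lconv_bounded Mv Nu) // addrC.
have -> : n = N + M - (absz (N + M - n)%R)%:Z by lia.
by rewrite (lconv_poly _ Nu Mv) (addrC N) (lconv_poly _ Mv Nu) mulrC.
Qed.

Lemma lconvA u v w : (exists N, lbounded N u) -> (exists N, lbounded N v) ->
  (exists N, lbounded N w) -> lconv u (lconv v w) = lconv (lconv u v) w.
Proof.
move=> [N Nu] [M Mv] [P Pw]; apply/funext => n.
have Nuv := lconv_bounded Nu Mv; have Nvw := lconv_bounded Mv Pw.
have [lt|le] := ltP (N + (M + P)) n.
  by rewrite (lconv_bounded Nu Nvw) // (lconv_bounded Nuv Pw) // -addrA.
have -> : n = N + (M + P) - (absz (N + (M + P) - n)%R)%:Z by lia.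
move: (absz _) => m; rewrite (lconvE _ Nu Nvw) addrA (lconvE _ Nuv Pw).
pose F := ltrunc N u m; pose G := ltrunc M v m; pose H := ltrunc P w m.
have FE i : (i <= m)%N -> F`_i = u (N - i%:Z) by rewrite coef_poly ltnS => ->.
have GE i : (i <= m)%N -> G`_i = v (M - i%:Z) by rewrite coef_poly ltnS => ->.
have HE i : (i <= m)%N -> H`_i = w (P - i%:Z) by rewrite coef_poly ltnS => ->.
transitivity ((F * (G * H))`_m); last rewrite mulrA.
  rewrite coefM; apply: eq_bigr => i _; have im : (i <= m)%N := ltn_ord i.
  rewrite FE // (lconvE _ Mv Pw) coefM; congr (_ * _); apply: eq_bigr => j _.
  by have := ltn_ord j => jm; rewrite GE ?HE //; lia.
rewrite coefM; apply: eq_bigr => i _; have im : (i <= m)%N := ltn_ord i.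
rewrite HE ?leq_subr // (lconvE _ Nu Mv) coefM; congr (_ * _).
apply: eq_bigr => j _.
by have := ltn_ord j => jm; rewrite FE ?GE //; lia.
Qed.

Lemma lzero_bounded : exists N, lbounded N (fun=> 0).
Proof. by exists 0. Qed.

Lemma ladd_bounded f g : exists N, lbounded N (fun n => lcoef f n + lcoef g n).
Proof.
case: (lcoef_bounded f) (lcoef_bounded g) => [N Nf] [M Mg].
exists (Num.max N M) => n; rewrite gt_max => /andP[/Nf -> /Mg ->].
exact: addr0.
Qed.

Lemma lopp_bounded f : exists N, lbounded N (fun n => - lcoef f n).
Proof.
by case: (lcoef_bounded f) => N Nf; exists N => n /Nf ->; rewrite oppr0.
Qed.

Lemma lmul_bounded f g : exists N, lbounded N (lconv (lcoef f) (lcoef g)).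
Proof.
case: (lcoef_bounded f) (lcoef_bounded g) => [N Nf] [M Mg].
by exists (N + M); apply: lconv_bounded.
Qed.

Lemma polyL_bounded (p : {poly K}) :
  exists N, lbounded N (fun n => if n is Posz k then p`_k else 0).
Proof.
exists (size p)%:Z => -[k|//] lt; rewrite nth_default //.
by move: lt; rewrite ltz_nat => /ltnW.
Qed.

Definition lzero := Laurent lzero_bounded.
Definition ladd f g := Laurent (ladd_bounded f g).
Definition lopp f := Laurent (lopp_bounded f).
Definition lmul f g := Laurent (lmul_bounded f g).
Definition polyL (p : {poly K}) := Laurent (polyL_bounded p).

Lemma laddA : associative ladd.
Proof. by move=> f g h; apply: laurentP => n; apply: addrA. Qed.
Lemma laddC : commutative ladd.
Proof. by move=> f g; apply: laurentP => n; apply: addrC. Qed.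
Lemma ladd0 : left_id lzero ladd.
Proof. by move=> f; apply: laurentP => n; apply: add0r. Qed.
Lemma laddN : left_inverse lzero lopp ladd.
Proof. by move=> f; apply: laurentP => n; apply: addNr. Qed.

HB.instance Definition _ :=
  GRing.isZmodule.Build (laurent K) laddA laddC ladd0 laddN.

Lemma lmulA : associative lmul.
Proof.
move=> f g h; apply: laurentP => n /=.
by rewrite lconvA //; apply: lcoef_bounded.
Qed.

Lemma lmulC : commutative lmul.
Proof.
move=> f g; apply: laurentP => n /=.
by rewrite lconvC //; apply: lcoef_bounded.
Qed.

Lemma lmul1 : left_id (polyL 1) lmul.
Proof.
move=> f; apply: laurentP => n /=; rewrite /lconv (fsbigE [:: 0%Z]) //=.
  by rewrite big_mkcond big_seq1 in_setT coef1 mul1r subr0.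
move=> [[|k]|k] _; rewrite !inE // => _; last by rewrite mul0r.
by rewrite coef1 mul0r.
Qed.

Lemma lmulDl : left_distributive lmul ladd.
Proof.
move=> f g h; apply: laurentP => n /=.
case: (lcoef_bounded f) (lcoef_bounded g) (lcoef_bounded h).
move=> N0 Nf0 [M0 Mg0] [P Ph].
pose N := Num.max N0 M0.
have Nf : lbounded N (lcoef f) by apply: (lboundedW _ Nf0); rewrite le_max lexx.
have Mg : lbounded N (lcoef g).
  by apply: (lboundedW _ Mg0); rewrite le_max lexx orbT.
have Nfg : lbounded N (fun n => lcoef f n + lcoef g n).
  by move=> k kN; rewrite Nf ?Mg ?addr0.
have [lt|le] := ltP (N + P) n.
  rewrite (lconv_bounded Nfg Ph) // (lconv_bounded Nf Ph) //.
  by rewrite (lconv_bounded Mg Ph) // addr0.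
have -> : n = N + P - (absz (N + P - n)%R)%:Z by lia.
rewrite (lconvE _ Nfg Ph) (lconvE _ Nf Ph) (lconvE _ Mg Ph) -big_split /=.
by apply: eq_bigr => i _; rewrite mulrDl.
Qed.

Lemma lone_neq0 : polyL 1 != lzero.
Proof.
apply/eqP => /(congr1 (fun f => lcoef f 0)) /=.
by rewrite coef1 /= => /eqP; rewrite oner_eq0.
Qed.

HB.instance Definition _ :=
  GRing.Zmodule_isComNzRing.Build (laurent K) lmulA lmulC lmul1 lmulDl lone_neq0.

Lemma lcoefD f g n : lcoef (f + g) n = lcoef f n + lcoef g n.
Proof. by []. Qed.
Lemma lcoefN f n : lcoef (- f) n = - lcoef f n.
Proof. by []. Qed.
Lemma lcoefM f g : lcoef (f * g) = lconv (lcoef f) (lcoef g).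
Proof. by []. Qed.

Lemma course_of_values (phi : nat -> (nat -> K) -> K) :
  (forall m u v, (forall k, (k < m)%N -> u k = v k) -> phi m u = phi m v) ->
  exists u : nat -> K, forall m, u m = phi m u.
Proof.
move=> phi_ext.
pose S := fix S m := if m is k.+1 then rcons (S k) (phi k (nth 0 (S k))) else [::].
have sS m : size (S m) = m by elim: m => //= m IH; rewrite size_rcons IH.
have nS m k : (k < m)%N -> nth 0 (S m) k = nth 0 (S k.+1) k.
  elim: m => // m IH; rewrite ltnS leq_eqVlt => /orP[/eqP -> //|km].
  by rewrite [LHS]/= nth_rcons sS km IH.
exists (fun m => nth 0 (S m.+1) m) => m /=.
rewrite nth_rcons sS ltnn eqxx; apply: phi_ext => k km.
by rewrite (nS _ _ km) /= nth_rcons sS.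
Qed.

Lemma laurent_lead f : f != 0 ->
  exists2 L, lcoef f L != 0 & lbounded L (lcoef f).
Proof.
move=> f0; case: (lcoef_bounded f) => N Nf.
have ex : exists k : nat, lcoef f (N - k%:Z) != 0.
  apply: contrapT => nex; case/eqP: f0; apply: laurentP => n.
  have [/Nf ->//|nN] := ltP N n.
  apply: contrapT => /eqP fn; apply: nex; exists (absz (N - n)).
  by have -> : N - `|(N - n)%R|%N%:Z = n by lia.
case: (ex_minnP ex) => k fk mink; exists (N - k%:Z) => // n ltn.
have [/Nf ->//|nN] := ltP N n.
apply: contrapT => /eqP fn.
have /mink : lcoef f (N - (absz (N - n))%:Z) != 0.
  by have -> : N - `|(N - n)%R|%N%:Z = n by lia.
lia.
Qed.

Lemma lbounded_of_nat L (u : nat -> K) :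
  lbounded L (fun n => if n <= L then u (absz (L - n)) else 0).
Proof. by move=> n; rewrite ltNge => /negbTE ->. Qed.

Definition laurent_of_nat L (u : nat -> K) : laurent K :=
  Laurent (ex_intro _ L (@lbounded_of_nat L u)).

Lemma laurent_of_natE L u (k : nat) :
  lcoef (laurent_of_nat L u) (L - k%:Z) = u k.
Proof.
have le : L - k%:Z <= L by lia.
by rewrite /= le; congr u; lia.
Qed.

Lemma lmul_inv_exists f : f != 0 -> exists g, g * f = 1.
Proof.
move=> /laurent_lead[L fL bL]; pose F k := lcoef f (L - k%:Z).
have F0 : F 0 != 0 by rewrite /F subr0.
pose phi m u := (F 0)^-1 * ((m == 0)%N%:R - \sum_(i < m) u i * F (m - i)%N).
case: (@course_of_values phi) => [m u v uv|u uE].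
  by congr (_ * (_ - _)); apply: eq_bigr => i _; rewrite uv.
exists (laurent_of_nat (- L) u); apply: laurentP => n.
have bu := @lbounded_of_nat (- L) u.
have [n0|n0] := ltP 0 n.
  rewrite lcoefM (lconv_bounded bu bL) ?addNr //=.
  by case: n n0 => [[|k]|k] //; rewrite coef1.
have -> : n = - L + L - (absz n)%:Z by lia.
rewrite lcoefM (lconvE _ bu bL) addNr; move: (absz n) => m.
transitivity (\sum_(i < m.+1) u i * F (m - i)%N).
  by apply: eq_bigr => i _; congr (_ * _); apply: laurent_of_natE.
rewrite big_ord_recr /= subnn uE /phi mulrAC mulVf // mul1r addrC subrK.
rewrite sub0r; case: m => [|m] //.
by rewrite -[RHS]/((1 : {poly K})`_0) coef1.
Qed.

Definition linv f : laurent K := xget 0 [set g | g * f = 1].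

Lemma lmulV f : f != 0 -> linv f * f = 1.
Proof. by move=> /lmul_inv_exists /(xgetPex 0). Qed.

Lemma linv0 : linv 0 = 0.
Proof.
by rewrite /linv; case: xgetP => // g _ /eqP; rewrite mulr0 eq_sym oner_eq0.
Qed.

HB.instance Definition _ :=
  GRing.ComNzRing_isField.Build (laurent K) lmulV linv0.

Lemma polyL_is_additive : zmod_morphism polyL.
Proof.
move=> p q; apply: laurentP => -[k|k]; rewrite lcoefD lcoefN /=.
  by rewrite coefB.
by rewrite subrr.
Qed.

Lemma polyL_is_multiplicative : monoid_morphism polyL.
Proof.
split=> // p q; apply: laurentP => n; rewrite lcoefM.
pose c (r : {poly K}) (n : int) := if n is Posz k then r`_k else 0.
rewrite -[lcoef (polyL p)]/(c p) -[lcoef (polyL q)]/(c q).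
case: n => [m|m] /=; last first.
  rewrite /lconv fsbig1 // => -[i|i] _; last by rewrite /= mul0r.
  have -> : Negz m - i%:Z = Negz (m + i) by rewrite !NegzE; lia.
  by rewrite /= mulr0.
rewrite /lconv (fsbigE [seq k%:Z | k <- iota 0 m.+1]).
- rewrite big_mkcond big_map.
  have -> : iota 0 m.+1 = index_iota 0 m.+1 by rewrite /index_iota subn0.
  rewrite big_mkord coefM; apply: eq_bigr => i _; rewrite in_setT.
  by have -> : m%:Z - i%:Z = (m - i)%N%:Z by have := ltn_ord i; lia.
- by rewrite map_inj_uniq ?iota_uniq // => x y [].
- by [].
move=> [i|i] _ im; last by rewrite /= mul0r.
have im' : (m < i)%N.
  rewrite ltnNge; apply/negP => le; case/negP: im.
  by apply/mapP; exists i => //; rewrite mem_iota ltnS.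
have -> : m%:Z - i%:Z = Negz (i - m).-1 by rewrite NegzE; lia.
by rewrite /= mulr0.
Qed.

HB.instance Definition _ :=
  GRing.isZmodMorphism.Build {poly K} (laurent K) polyL polyL_is_additive.
HB.instance Definition _ :=
  GRing.isMonoidMorphism.Build {poly K} (laurent K) polyL polyL_is_multiplicative.

End LaurentRing.

Section ContinuedFraction.
Variable K : fieldType.
Implicit Types (f : laurent K) (E p q : {poly K}).

Definition lbound f : int := projT1 (cid (lcoef_bounded f)).

(* The sum of the terms with nonnegative exponent; the bound on the index is
   immaterial, cf. coef_lfloor. *)
Definition lfloor f : {poly K} := \poly_(k < (absz (lbound f)).+1) lcoef f k%:Z.

Lemma coef_lfloor f (k : nat) : (lfloor f)`_k = lcoef f k%:Z.
Proof.
rewrite coef_poly; case: ltnP => // le.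
have fb : lbounded (lbound f) (lcoef f) := projT2 (cid (lcoef_bounded f)).
by rewrite fb //; move: (lbound f) le => N le; lia.
Qed.

(* [s] is the square root of [E] with leading term t^e, where deg E = 2e. *)
Definition is_lsqrt E (s : laurent K) :=
  [/\ s ^+ 2 = polyL E,
      lcoef s ((size E).-1./2)%:Z = 1 &
      forall n : int, ((size E).-1./2)%:Z < n -> lcoef s n = 0].

Definition lsqrt E : laurent K := xget 0 [set s | is_lsqrt E s].

Lemma is_lsqrt_unique E s1 s2 :
  (2 != 0 :> K) -> is_lsqrt E s1 -> is_lsqrt E s2 -> s1 = s2.
Proof.
move=> two [s1E s11 _] [s2E s21 _]; apply/eqP; rewrite -subr_eq0.
have /eqP : (s1 - s2) * (s1 + s2) = 0 by rewrite -subr_sqr s1E s2E subrr.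
rewrite mulf_eq0 => /orP[//|/eqP/(congr1 (fun s => lcoef s (size E).-1./2%:Z))].
by rewrite lcoefD s11 s21 => /eqP; rewrite /= -[1 + 1]/(2%:R) (negPf two).
Qed.

Lemma lsqrt_exists E : (2 != 0 :> K) -> E \is monic -> ~~ odd (size E).-1 ->
  exists s, is_lsqrt E s.
Proof.
move=> two monE oddE; set e := (size E).-1./2.
have eE : (size E).-1 = (e + e)%N.
  by rewrite addnn -[LHS]odd_double_half (negPf oddE).
pose F k := lcoef (polyL E) (e%:Z + e%:Z - k%:Z).
have bE : lbounded (e%:Z + e%:Z) (lcoef (polyL E)).
  move=> [k|k] //=; rewrite -PoszD ltz_nat -eE => lt.
  by rewrite nth_default //; case: (size E) lt.
have F0 : F 0 = 1.
  rewrite /F; have -> : e%:Z + e%:Z - 0%:Z = (e + e)%N%:Z by lia.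
  by rewrite /= -eE; apply/eqP.
pose phi m (u : nat -> K) := if m is m'.+1 then
  2^-1 * (F m - \sum_(i < m') u i.+1 * u (m' - i)%N) else 1.
case: (@course_of_values K phi) => [[|m] u v uv //=|u uE].
  congr (_ * (_ - _)); apply: eq_bigr => i _.
  by rewrite !uv //; have := ltn_ord i; lia.
have bu := @lbounded_of_nat K e%:Z u.
exists (laurent_of_nat e%:Z u); split=> //; last first.
  by rewrite -[X in lcoef _ X]subr0 (laurent_of_natE e%:Z u 0) uE.
apply: laurentP => n; rewrite expr2 lcoefM.
have [lt|le] := ltP (e%:Z + e%:Z) n; first by rewrite (lconv_bounded bu bu) // bE.
have -> : n = e%:Z + e%:Z - (absz (e%:Z + e%:Z - n)%R)%:Z by lia.
move: (absz _) => m; rewrite (lconvE _ bu bu) -/(F m).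
transitivity (\sum_(i < m.+1) u i * u (m - i)%N).
  by apply: eq_bigr => i _; congr (_ * _); apply: (laurent_of_natE e%:Z u).
case: m => [|m].
  by rewrite big_ord_recl big_ord0 addr0 F0 subnn uE mulr1.
rewrite big_ord_recl big_ord_recr /= subn0 subnn.
have -> : \sum_(i < m) u (bump 0 i) * u (m.+1 - bump 0 i)%N =
          \sum_(i < m) u i.+1 * u (m - i)%N by [].
rewrite [u 0%N]uE mul1r mulr1 addrCA -mulr2n -mulr_natl uE mulrA divff // mul1r.
by rewrite addrC subrK.
Qed.

Lemma lsqrtP E : (2 != 0 :> K) -> E \is monic -> ~~ odd (size E).-1 ->
  is_lsqrt E (lsqrt E).
Proof. by move=> two mE oE; apply: xgetPex; apply: lsqrt_exists. Qed.

(* The expansion stops when some remainder [alpha_n - a_n] vanishes; all later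
   terms are then 0, by the convention 0^-1 = 0. *)
Fixpoint cf_alpha f (n : nat) : laurent K :=
  if n is m.+1 then (cf_alpha f m - polyL (lfloor (cf_alpha f m)))^-1 else f.

Definition cf_quot f (n : nat) : {poly K} := lfloor (cf_alpha f n).

Fixpoint cf_num f (n : nat) : {poly K} :=
  match n with
  | 0 => 1
  | n1.+1 => match n1 with
             | 0 => cf_quot f 0
             | n2.+1 => cf_quot f n1 * cf_num f n1 + cf_num f n2
             end
  end.

Fixpoint cf_den f (n : nat) : {poly K} :=
  match n with
  | 0 => 0
  | n1.+1 => match n1 with
             | 0 => 1
             | n2.+1 => cf_quot f n1 * cf_den f n1 + cf_den f n2
             end
  end.

(* A convergent is a fraction p/q, so a pair (p, q) counts as a convergent up to
   a common nonzero constant. The constant that the recurrence attaches to a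
   given fraction depends on the whole expansion of [f]: two series sharing a
   convergent p/q in general produce distinct multiples of (p, q). *)
Definition is_convergent f p q :=
  exists m : nat, exists2 c : K, c != 0 &
    p = c *: cf_num f m /\ q = c *: cf_den f m.

End ContinuedFraction.

Definition is_root_of_unity (K : fieldType) (z : K) : Prop :=
  exists2 k : nat, (0 < k)%N & z ^+ k = 1.

(* Main.v *)
(* A convergent p/q = p_n/q_n of sqrt D with m = deg p and deg a_n = l satisfies
   ord (p - q sqrt D) = m - d + l at infinity.  Substituting t = (x + 1/x)/2,
   sqrt(t^2 - 1) = (x - 1/x)/2, the function P(x) = x^m (p - q sqrt D) is a nonzero
   polynomial of degree at most d - l, and D_1(rho_i) = 0 turns into
     P(b_i) = b_i^(2m) P(1/b_i)   for all i.

   (1) If l >= r + 2, then P has at most g - r coefficients, and they solve the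
   g - r equations attached to the b_i that are not roots of unity.  The determinant of this
   system is an exponential sum in m all of whose coefficients are Vandermonde
   determinants, hence nonzero.  If it vanished for infinitely many m, it would
   vanish on an arithmetic progression by the Skolem-Mahler-Lech theorem; but some
   exponential occurs exactly once, because the b_i in question have infinite order.

   (2) If l >= d - r, then deg P <= r.  The equations at the b_i of finite order
   depend on m only modulo some T, and they determine P(x)/P(1/x): for two
   solutions P, Q the Laurent polynomial P(x)Q(1/x) - P(1/x)Q(x) vanishes at the
   2r points b_i, 1/b_i and at 1, -1.  So if P(b_i) <> 0 for some b_i of infinite
   order, then b_i^(2m) is determined by m mod T, and m is bounded.  Otherwise
   p vanishes at all rho_i, i > r, and Legendre's criterion shows
   that p/prod (t - rho_i) and q form a convergent of sqrt D_p.

   The Skolem-Mahler-Lech theorem is proved p-adically, but without completions: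
   finitely many elements of a field of characteristic 0 lie in a subring A with
   p-adically separated powers in which a suitable power of each of them is 1 mod p. *)
Require Import Defs.
From HB Require Import structures.
From mathcomp Require Import all_boot all_order all_algebra.
From mathcomp Require Import boolp classical_sets functions cardinality fsbigop.
From mathcomp Require Import reals complex.
From mathcomp Require Import perm fieldext zify ring.

Set Implicit Arguments.
Unset Strict Implicit.
Unset Printing Implicit Defensive.

Import Order.TTheory GRing.Theory Num.Theory.
Local Open Scope ring_scope.

(** * Zeros of Mahler series *)

Definition char_zero (F : fieldType) := forall n, (n%:R == 0 :> F) = (n == 0)%N.

Lemma char_zero_inj (F : fieldType) : char_zero F -> injective (fun n => n%:R : F).
Proof.
move=> ch0 i j; wlog le : i j / (i <= j)%N.
  by move=> W ij; case: (leqP i j) => [/W->//|/ltnW/W/(_ (esym ij))].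
move=> /= ij; have : (j - i)%N%:R = 0 :> F by rewrite natrB // ij subrr.
by move/eqP; rewrite ch0 subn_eq0 => ji; apply/eqP; rewrite eqn_leq le.
Qed.

(** * Subrings of a field and polynomials with coefficients in them *)

Section Subrings.
Variable F : fieldType.

Record subring (A : F -> Prop) : Prop := Subring {
  subring1 : A 1;
  subringB : forall x y, A x -> A y -> A (x - y);
  subringM : forall x y, A x -> A y -> A (x * y)
}.

Variables (A : F -> Prop) (sA : subring A).

Lemma subring0 : A 0.
Proof. by rewrite -(subrr 1); apply: subringB sA _ _ _ _; apply: subring1. Qed.

Lemma subringN x : A x -> A (- x).
Proof. by move=> Ax; rewrite -sub0r; apply: (subringB sA) => //; apply: subring0. Qed.

Lemma subringD x y : A x -> A y -> A (x + y).
Proof. by move=> Ax Ay; rewrite -[y]opprK; apply: (subringB sA) => //; apply: subringN. Qed.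

Lemma subring_sum (I : Type) (r : seq I) (P : pred I) (u : I -> F) :
  (forall i, P i -> A (u i)) -> A (\sum_(i <- r | P i) u i).
Proof. by move=> Au; elim/big_ind: _ => //; [apply: subring0 | apply: subringD]. Qed.

Lemma subringX x n : A x -> A (x ^+ n).
Proof.
move=> Ax; elim: n => [|n IH]; first by rewrite expr0; apply: subring1.
by rewrite exprS; apply: (subringM sA).
Qed.

Lemma subring_nat n : A n%:R.
Proof.
elim: n => [|n IH]; first exact: subring0.
by rewrite -addn1 natrD; apply: subringD => //; apply: subring1.
Qed.

Definition coefs_in (f : {poly F}) := forall i, A f`_i.

Lemma coefs_in0 : coefs_in 0.
Proof. by move=> i; rewrite coef0; apply: subring0. Qed.

Lemma coefs_inC c : A c -> coefs_in c%:P.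
Proof. by move=> Ac i; rewrite coefC; case: ifP => // _; apply: subring0. Qed.

Lemma coefs_inX : coefs_in 'X.
Proof. by move=> i; rewrite coefX; apply: subring_nat. Qed.

Lemma coefs_inD f g : coefs_in f -> coefs_in g -> coefs_in (f + g).
Proof. by move=> Af Ag i; rewrite coefD; apply: subringD. Qed.

Lemma coefs_inB f g : coefs_in f -> coefs_in g -> coefs_in (f - g).
Proof. by move=> Af Ag i; rewrite coefB; apply: subringB. Qed.

Lemma coefs_inM f g : coefs_in f -> coefs_in g -> coefs_in (f * g).
Proof.
by move=> Af Ag i; rewrite coefM; apply: subring_sum => j _; apply: (subringM sA).
Qed.

Lemma coefs_inZ c f : A c -> coefs_in f -> coefs_in (c *: f).
Proof. by move=> Ac Af i; rewrite coefZ; apply: (subringM sA). Qed.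

Lemma coefs_in_sum (I : Type) (r : seq I) (P : pred I) (u : I -> {poly F}) :
  (forall i, P i -> coefs_in (u i)) -> coefs_in (\sum_(i <- r | P i) u i).
Proof. by move=> Au i; rewrite coef_sum; apply: subring_sum => j /Au. Qed.

Lemma coefs_in_horner f x : coefs_in f -> A x -> A f.[x].
Proof.
move=> Af Ax; rewrite horner_coef; apply: subring_sum => i _.
by apply: (subringM sA) => //; apply: subringX.
Qed.

(** The divisor is monic, so Horner's scheme needs no division and the quotient stays over [A]. *)
Lemma synthetic_division f a : coefs_in f -> A a ->
  exists2 q, coefs_in q & f = ('X - a%:P) * q + f.[a]%:P.
Proof.
move=> + Aa; elim/poly_ind: f => [_|f c IH Af].
  by exists 0; [exact: coefs_in0 | rewrite horner0 mulr0 addr0].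
have Af' : coefs_in f.
  by move=> i; have := Af i.+1; rewrite coefD coefMX coefC /= addr0.
have [q Aq fE] := IH Af'; exists ('X * q + f.[a]%:P).
  apply: coefs_inD; first by apply: coefs_inM => //; apply: coefs_inX.
  by apply: coefs_inC; apply: coefs_in_horner.
by rewrite hornerMXaddC {1}fE polyCD polyCM; ring.
Qed.

End Subrings.

(** Legendre's formula, summed by induction: [2 * (i %/ p) + i %/ p <= p * (i %/ p) <= i], which is
    where [p > 2] enters. *)
Lemma double_logn_fact p j : prime p -> (2 < p)%N -> (2 * logn p j`! <= j)%N.
Proof.
move=> pp p2; rewrite logn_fact //.
suff H n i : (2 * \sum_(1 <= k < n.+1) i %/ p ^ k <= i)%N by apply: H.
elim: n i => [|n IH] i; first by rewrite big_geq.
rewrite big_nat_recl //= expn1.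
have -> : (\sum_(1 <= k < n.+1) i %/ p ^ k.+1 = \sum_(1 <= k < n.+1) (i %/ p) %/ p ^ k)%N.
  by apply: eq_bigr => k _; rewrite expnS divnMA.
have := IH (i %/ p)%N; have := leq_trunc_div i p.
have : (i %/ p * 3 <= i %/ p * p)%N by rewrite leq_mul2l p2 orbT.
lia.
Qed.

(** * Strassman's argument with divisibility in place of convergence *)

Section Strassman.
Variables (F : fieldType) (p : nat) (A : F -> Prop).
Hypothesis char0 : char_zero F.
Hypotheses (pp : prime p) (p2 : (2 < p)%N) (sA : subring A).
Hypothesis A_inv : forall n, coprime n p -> A n%:R^-1.
Hypothesis A_sep : forall a, (forall j, exists2 b, A b & a = p%:R ^+ j * b) -> a = 0.

Let p_neq0 : p%:R != 0 :> F.
Proof. by rewrite char0 -lt0n prime_gt0. Qed.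

(** The roots are divided out one at a time. The quotients of [f] and [h] stay over [A], while [G]
    shrinks to zero; what is left of [f] is then a multiple of [p ^ e]. *)
Lemma dvd_poly_of_roots e (ks : seq nat) (f G h : {poly F}) :
  uniq ks -> coefs_in A f -> coefs_in A h -> f = G + p%:R ^+ e *: h ->
  (size G <= size ks)%N -> all (fun k => root f k%:R) ks ->
  exists2 h', coefs_in A h' & f = p%:R ^+ e *: h'.
Proof.
elim: ks f G h => [|k ks IH] f G h /=.
  move=> _ _ Ah -> /[!leqn0] /[!size_poly_eq0] /eqP-> _.
  by exists h => //; rewrite add0r.
move=> /andP[kks uks] Af Ah fE sG /andP[rk rks].
have Ak : A k%:R by apply: subring_nat.
have [f' Af' fE'] := synthetic_division sA Af Ak.
have [h' Ah' hE'] := synthetic_division sA Ah Ak.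
(* The coefficients of [G] are arbitrary elements of [F], so this division uses the whole field as
   subring. *)
have [G' _ GE'] := @synthetic_division F xpredT ltac:(done) G k%:R ltac:(done) erefl.
move: (rk) => /rootP fk0; rewrite fk0 addr0 in fE'.
have c0 : G.[k%:R] + p%:R ^+ e * h.[k%:R] = 0.
  by rewrite -fk0 fE hornerD hornerZ.
have f'E : f' = G' + p%:R ^+ e *: h'.
  have X0 : 'X - k%:R%:P != 0 :> {poly F} by rewrite polyXsubC_eq0.
  apply: (mulfI X0); rewrite -fE' {1}fE {1}GE' {1}hE' scalerDr mulrDr -scalerAr.
  rewrite addrACA -[RHS]addr0; congr (_ + _).
  by rewrite -mul_polyC -polyCM -polyCD c0.
have sG' : (size G' <= size ks)%N.
  have [->|G'0] := eqVneq G' 0; first by rewrite size_poly0.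
  have s1 : size (('X - k%:R%:P) * G') = (size G').+1.
    by rewrite size_mul ?polyXsubC_eq0 // size_XsubC.
  have s2 : (1 < size (('X - k%:R%:P) * G')%R)%N.
    by rewrite s1 ltnS size_poly_gt0.
  rewrite -ltnS; apply: leq_trans sG; rewrite -s1 [in leqRHS]GE' size_polyDl //.
  by apply: leq_ltn_trans s2; apply: size_polyC_leq1.
have rks' : all (fun k => root f' k%:R) ks.
  apply/allP => i iks; have := allP rks i iks.
  rewrite fE' rootM root_XsubC => /orP[/eqP ik|//].
  by move: kks; rewrite -(char_zero_inj char0 ik) iks.
have [h'' Ah'' f'E2] := IH _ _ _ uks Af' Ah' f'E sG' rks'.
exists (('X - k%:R%:P) * h''); last by rewrite fE' f'E2 scalerAr.
apply: coefs_inM => //; apply: coefs_inB => //; first exact: coefs_inX.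
exact: coefs_inC.
Qed.

(** At most half of the factors [p] are absorbed by [j!], and the part of [j!] prime to [p] is
    invertible in [A]. *)
Lemma exp_div_fact j : exists2 u, A u & p%:R ^+ j / j`!%:R = p%:R ^+ j./2 * u.
Proof.
have f0 := fact_gt0 j.
have [m cm jE] := pfactor_coprime pp f0.
have := double_logn_fact j pp p2; set v := logn p j`! in jE * => vj.
exists (p%:R ^+ (j - v - j./2) * m%:R^-1).
  apply: (subringM sA); first by apply: subringX => //; apply: subring_nat.
  by apply: A_inv; rewrite coprime_sym.
have -> : p%:R ^+ j = p%:R ^+ j./2 * p%:R ^+ (j - v - j./2) * p%:R ^+ v :> F.
  rewrite -!exprD; congr (_ ^+ _); have := odd_double_half j; lia.
by rewrite jE natrM natrX invfM !mulrA [LHS]mulrAC mulfK ?expf_neq0.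
Qed.

(** The falling factorial, that is [j!] times the binomial polynomial of degree [j]. *)
Definition ffact_poly j : {poly F} := \prod_(i < j) ('X - i%:R%:P).

Lemma ffact_polyE j (k : nat) : (ffact_poly j).[k%:R] = (k ^_ j)%:R.
Proof.
rewrite /ffact_poly horner_prod.
elim: j => [|j IH]; first by rewrite big_ord0.
rewrite big_ord_recr /= IH ffactnSr natrM hornerXsubC.
have [jk|kj] := leqP j k; first by rewrite natrB.
by rewrite ffact_small // !mul0r.
Qed.

(** A Mahler series with coefficients [p ^ j * d j]. At a natural number [k] it is a finite sum,
    since the binomials with [j > k] vanish. *)
Variables (d f : nat -> F).
Hypothesis Ad : forall j, A (d j).
Hypothesis fE : forall N k, (k < N)%N ->
  f k = \sum_(j < N) 'C(k, j)%:R * p%:R ^+ j * d j.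

Let term j : {poly F} := (p%:R ^+ j / j`!%:R * d j) *: ffact_poly j.

Let Aterm j : exists2 h, coefs_in A h & term j = p%:R ^+ j./2 *: h.
Proof.
have [u Au uE] := exp_div_fact j; exists ((u * d j) *: ffact_poly j).
  apply: coefs_inZ => //; first by apply: (subringM sA).
  rewrite /ffact_poly; elim/big_ind: _ => //.
  - by apply: coefs_inC => //; apply: subring1.
  - exact: coefs_inM.
  move=> i _; apply: coefs_inB => //; first exact: coefs_inX.
  by apply: coefs_inC => //; apply: subring_nat.
by rewrite /term uE scalerA mulrA.
Qed.

Let trunc N := \sum_(j < N) term j.

Let truncE N k : (k < N)%N -> (trunc N).[k%:R] = f k.
Proof.
move=> kN; rewrite (fE kN) horner_sum; apply: eq_bigr => j _.
rewrite hornerZ ffact_polyE -bin_ffact natrM.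
have j0 : j`!%:R != 0 :> F by rewrite char0 -lt0n fact_gt0.
by field.
Qed.

(** Modulo [p ^ e] the series is a polynomial of degree less than [2e]. It has [2e] zeros, so all
    its values are divisible by [p ^ e]; as [e] is arbitrary, separatedness makes them 0. *)
Theorem mahler_zeros : (forall N, exists2 k, (N <= k)%N & f k = 0) -> forall k, f k = 0.
Proof.
move=> zeros k; apply: A_sep => e.
have [ks [uks sks zks]] : exists ks, [/\ uniq ks, size ks = e.*2 & forall i, i \in ks -> f i = 0].
  elim: (e.*2) => [|n [ks [uks sks zks]]]; first by exists [::].
  (* A zero exceeding the sum of the zeros already listed is a new one. *)
  have [i iN fi] := zeros (\sum_(j <- ks) j).+1.
  exists (i :: ks); split=> /=; [|by rewrite sks|].
    rewrite uks andbT; apply/negP => iks.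
    by rewrite (big_rem i) //= in iN; lia.
  by move=> j /[!inE] /predU1P[->//|/zks].
(* Truncating at [N] changes neither the value at [k] nor the chosen zeros, and keeps all terms
   below [2e]. *)
pose N := maxn (maxn k.+1 e.*2) (\sum_(j <- ks) j).+1.
have ksN i : i \in ks -> (i < N)%N.
  move=> iks; rewrite /N !leq_max; apply/orP; right.
  by rewrite (big_rem i) //= ltnS leq_addr.
have kN : (k < N)%N by rewrite /N !leq_max leqnn.
have eN : (e.*2 <= N)%N by rewrite /N !leq_max leqnn !orbT.
have Atr : coefs_in A (trunc N).
  apply: coefs_in_sum => // j _; have [h Ah ->] := Aterm j.
  by apply: coefs_inZ => //; apply: subringX => //; apply: subring_nat.
have [h Ah hE] : exists2 h, coefs_in A h & trunc N = trunc e.*2 + p%:R ^+ e *: h.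
  rewrite -(subnKC eN) {1}/trunc big_split_ord /=.
  elim: (N - e.*2)%N => [|n [h Ah IH]].
    by rewrite big_ord0; exists 0; [exact: coefs_in0 | rewrite scaler0].
  rewrite big_ord_recr /= addrA IH; have [h' Ah' ->] := Aterm (e.*2 + n).
  exists (h + p%:R ^+ ((e.*2 + n)./2 - e) *: h').
    apply: coefs_inD => //; apply: coefs_inZ => //.
    by apply: subringX => //; apply: subring_nat.
  rewrite scalerDr scalerA -exprD addrA; congr (_ + _ ^+ _ *: _).
  by rewrite halfD odd_double doubleK /=; lia.
have sz : (size (trunc e.*2) <= size ks)%N.
  rewrite sks; apply: (leq_trans (size_sum _ _ _)); apply/bigmax_leqP => j _.
  apply: (leq_trans (size_scale_leq _ _)); rewrite /ffact_poly size_prod_XsubC.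
  by rewrite /index_enum -enumT size_enum_ord.
have rks : all (fun k => root (trunc N) k%:R) ks.
  by apply/allP => i iks; apply/rootP; rewrite truncE ?ksN // zks.
have [h' Ah' tE] := dvd_poly_of_roots uks Atr Ah hE sz rks.
exists h'.[k%:R]; first by apply: coefs_in_horner => //; apply: subring_nat.
by rewrite -(truncE kN) tE hornerZ.
Qed.

End Strassman.

(** * The Skolem-Mahler-Lech theorem *)

(* A substitute for an embedding of F into Q_p that makes the elements of S units:
   A plays the role of Z_p, and A0 that of a subring with finite image in A/pA. *)
Record padic_frame (F : fieldType) (S : seq F) (p : nat) (A A0 : F -> Prop)
    (reps : seq F) : Prop := PadicFrame {
  frame_prime : prime p;
  frame_gt2 : (2 < p)%N;
  frame_subring : subring A;
  frame_subring0 : subring A0;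
  frame_sub : forall x, A0 x -> A x;
  frame_inv : forall n, coprime n p -> A n%:R^-1;
  frame_sep : forall a, (forall j, exists2 b, A b & a = p%:R ^+ j * b) -> a = 0;
  frame_fin : forall x, A0 x ->
    exists2 e, e \in reps & exists2 b, A b & x = e + p%:R * b;
  frame_unit : forall s, s \in S -> s != 0 -> A0 s /\ A0 s^-1
}.

Definition framed (F : fieldType) :=
  forall S : seq F, exists p A A0 reps, padic_frame S p A A0 reps.

(** * Making powers congruent to 1 modulo p *)

Section FrameExponent.
Variables (F : fieldType) (S : seq F) (p : nat) (A A0 : F -> Prop) (reps : seq F).
Hypothesis fr : padic_frame S p A A0 reps.

Lemma frame_exp1 b k : A b -> exists2 b', A b' & (1 + p%:R * b) ^+ k = 1 + p%:R * b'.
Proof.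
have sA := frame_subring fr.
move=> Ab; elim: k => [|k [b' Ab' IH]].
  by exists 0; [apply: subring0 | rewrite expr0 mulr0 addr0].
exists (b' + b + p%:R * (b * b')); last by rewrite exprS IH; ring.
apply: subringD => //; first exact: subringD.
by apply: (subringM sA); [apply: subring_nat | apply: (subringM sA)].
Qed.

(** Pigeonhole: the powers of [s] lie in [A0] and meet finitely many classes modulo [p]. Two powers
    in one class differ by a factor congruent to 1, because [s^-1] also lies in [A0]. *)
Lemma frame_order s : s \in S -> s != 0 ->
  exists2 t, (0 < t)%N & exists2 b, A b & s ^+ t = 1 + p%:R * b.
Proof.
move=> sS s0; have [A0s A0sV] := frame_unit fr sS s0.
have sA := frame_subring fr; have sA0 := frame_subring0 fr.
have /choice[rep repP] : forall n, exists e, e \in reps /\ exists2 b, A b & s ^+ n = e + p%:R * b.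
  by move=> n; have [e er eb] := frame_fin fr (subringX sA0 n A0s); exists e.
pose h (i : 'I_(size reps).+1) : 'I_(size reps) :=
  Ordinal (etrans (index_mem (rep i) reps) (repP i).1).
have /injectivePn[i [j ij hij]] : ~~ injectiveb h.
  by apply/negP => /injectiveP /leq_card; rewrite !card_ord ltnn.
have repij : rep i = rep j.
  by rewrite -(nth_index 0 (repP i).1) -(nth_index 0 (repP j).1); congr nth; case: hij.
wlog lt : i j ij hij repij / (i < j)%N.
  move=> W; case: (ltngtP i j) => [lt|lt|e]; first exact: (W i j).
    by apply: (W j i) => //; rewrite eq_sym.
  by rewrite -val_eqE /= e eqxx in ij.
have [_ [bi Abi siE]] := repP i; have [_ [bj Abj sjE]] := repP j.
exists (j - i)%N; first by rewrite subn_gt0.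
exists ((bj - bi) * s^-1 ^+ i).
  apply: (subringM sA); first exact: (subringB sA).
  by apply: subringX => //; apply: frame_sub fr _ _.
have -> : s ^+ (j - i) = s ^+ j * s^-1 ^+ i.
  by rewrite exprVn -expfB // expfB.
have one : s ^+ i * s^-1 ^+ i = 1 by rewrite -exprMn divff // expr1n.
rewrite -[X in _ = X + _]one siE sjE repij; ring.
Qed.

Lemma frame_common_order (I : finType) (a : I -> F) :
  (forall i, a i \in S) -> (forall i, a i != 0) ->
  exists2 T, (0 < T)%N & forall i, exists2 b, A b & a i ^+ T = 1 + p%:R * b.
Proof.
move=> aS a0; have /choice[t tP] : forall i, exists t,
    (0 < t)%N /\ exists2 b, A b & a i ^+ t = 1 + p%:R * b.
  by move=> i; have [t] := frame_order (aS i) (a0 i); exists t.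
exists (\prod_i t i)%N; first by rewrite prodn_gt0 // => i; apply: (tP i).1.
move=> i; rewrite (bigD1 i) //= exprM; have [_ [b Ab ->]] := tP i.
exact: frame_exp1.
Qed.

End FrameExponent.

(** If [a i ^+ T = 1 + p z i], the binomial expansion of [(1 + p z i) ^+ k] turns the sum along
    [r + T * k] into a Mahler series in [k]. The same [T] serves all [r]. *)
Theorem framed_skolem_mahler_lech (F : fieldType) : char_zero F -> framed F ->
  forall (I : finType) (c a : I -> F), (forall i, a i != 0) ->
  exists2 T, (0 < T)%N & forall r,
  (forall N, exists2 k, (N <= k)%N & \sum_i c i * a i ^+ (r + T * k) = 0) ->
  forall k, \sum_i c i * a i ^+ (r + T * k) = 0.
Proof.
move=> ch0 frF I c a a0.
have [p [A [A0 [reps fr]]]] := frF (codom c ++ codom a).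
have aS i : a i \in codom c ++ codom a by rewrite mem_cat codom_f orbT.
have cS i : c i \in codom c ++ codom a by rewrite mem_cat codom_f.
have [T T0 /choice[z zP]] : exists2 T, (0 < T)%N &
    forall i, exists z, A z /\ a i ^+ T = 1 + p%:R * z.
  have [T T0 aT] := frame_common_order fr aS a0.
  by exists T => // i; have [z] := aT i; exists z.
exists T => // r; have sA := frame_subring fr.
have Aa i : A (a i) by apply: (frame_sub fr); have [] := frame_unit fr (aS i) (a0 i).
have Ac i : A (c i).
  have [->|ci0] := eqVneq (c i) 0; first exact: subring0.
  by apply: (frame_sub fr); have [] := frame_unit fr (cS i) ci0.
apply: (@mahler_zeros F p A ch0 (frame_prime fr) (frame_gt2 fr) sA
  (frame_inv fr) (frame_sep fr) (fun j => \sum_i c i * a i ^+ r * z i ^+ j)).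
  move=> j; apply: subring_sum => // i _; apply: (subringM sA); last exact: subringX (zP i).1.
  by apply: (subringM sA) => //; apply: subringX.
move=> N k kN.
have bE x : (1 + x) ^+ k = \sum_(j < N) 'C(k, j)%:R * x ^+ j :> F.
  rewrite exprDn (big_ord_widen N (fun j => 1 ^+ (k - j) * x ^+ j *+ 'C(k, j))) //.
  rewrite big_mkcond; apply: eq_bigr => j _.
  case: ltnP => kj; last by rewrite bin_small ?mul0r.
  by rewrite expr1n mul1r mulr_natl.
transitivity (\sum_i \sum_(j < N) 'C(k, j)%:R * p%:R ^+ j * (c i * a i ^+ r * z i ^+ j)).
  apply: eq_bigr => i _; rewrite exprD exprM (zP i).2 bE mulrA mulr_sumr.
  by apply: eq_bigr => j _; rewrite exprMn; ring.
by rewrite exchange_big; apply: eq_bigr => j _; rewrite mulr_sumr.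
Qed.

(** Both rings are the localization of the integers at a prime [p] larger than all numerators and
    denominators in [S]; the residues are 0, ..., p - 1. *)
Lemma framed_rat : framed rat.
Proof.
move=> S.
pose M := (\sum_(s <- S) (`|numq s| + `|denq s|) + 2)%N.
have [p pM pp] := prime_above M.
have p2 : (2 < p)%N by apply: leq_ltn_trans pM; rewrite /M leq_addl.
have p0 : p%:R != 0 :> rat by rewrite pnatr_eq0 -lt0n prime_gt0.
pose A (x : rat) := exists n : int, exists2 d : nat, coprime d p & x = n%:~R / d%:R.
have nz d : coprime d p -> d%:R != 0 :> rat.
  rewrite pnatr_eq0; apply: contraTneq => ->.
  by rewrite /coprime gcd0n; apply: contraTneq p2 => ->.
have sA : subring A.
  split.
  - by exists 1, 1%N; rewrite ?coprime1n // divr1.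
  - move=> _ _ [n [d cd ->]] [n' [d' cd' ->]].
    exists (n * d'%:Z - n' * d%:Z), (d * d')%N; first by rewrite coprimeMl cd.
    have := nz _ cd; have := nz _ cd' => d'0 d0.
    rewrite rmorphB /= !intrM natrM -!pmulrn; field.
    by rewrite d'0 d0.
  - move=> _ _ [n [d cd ->]] [n' [d' cd' ->]].
    exists (n * n'), (d * d')%N; first by rewrite coprimeMl cd.
    by rewrite intrM natrM invfM mulrACA.
have Ainv n : coprime n p -> A n%:R^-1 by move=> cn; exists 1, n; rewrite ?mul1r.
exists p, A, A, [seq e%:R | e <- iota 0 p]; split=> //.
- move=> a aP.
  have Aa : A a by have [b Ab ->] := aP 0; rewrite expr0 mul1r.
  case: (Aa) => n [d cd aE].
  suff n0 : n = 0 by rewrite aE n0 mul0r.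
  (* The exponent [|n| + 1] suffices: [p ^ (|n| + 1)] exceeds [|n|], so it cannot divide a nonzero
     [n]. *)
  case: (aP `|n|.+1) => _ [n' [d' cd' ->]] aE'.
  have d0 := nz _ cd; have d'0 := nz _ cd'.
  have nE : n * d'%:Z = p%:Z ^+ `|n|.+1 * n' * d%:Z.
    apply/eqP; rewrite -(eqr_int rat) !intrM rmorphXn /= -!pmulrn; apply/eqP.
    have : n%:~R / d%:R = p%:R ^+ `|n|.+1 * (n'%:~R / d'%:R) :> rat by rewrite -aE.
    move/(congr1 (fun x => x * d%:R * d'%:R)).
    by rewrite divfK // => ->; field.
  have : (p ^ `|n|.+1 %| `|n| * d')%N.
    have := congr1 absz nE; rewrite !abszM abszX /= => ->.
    by rewrite -mulnA dvdn_mulr.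
  rewrite Gauss_dvdl; last by rewrite coprimeXl // coprime_sym.
  case: (posnP `|n|%N) => [/eqP|n0 /(dvdn_leq n0)]; first by rewrite absz_eq0 => /eqP.
  rewrite leqNgt => /negP[]; apply: leq_trans (ltn_expl _ (prime_gt1 pp)) _.
  by rewrite leq_exp2l ?prime_gt1.
- move=> _ [n [d cd ->]]; have d0 := nz _ cd.
  have dp : (0 < d)%N by rewrite lt0n; move: d0; rewrite pnatr_eq0.
  (* Here [w * d = 1 + u * p], so [w] inverts [d] modulo [p] and the residue of [n / d] is that of
     [n * w]. *)
  have [u _] := Bezoutl p dp; rewrite (eqP (cd : gcdn d p == 1%N)) => /dvdnP[w wE].
  have qE := divz_eq (n * w%:Z) p%:Z.
  set q := (_ %/ _)%Z in qE; set e := (_ %% _)%Z in qE.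
  have p0' : p%:Z != 0 by rewrite eqz_nat -lt0n prime_gt0.
  have ltp : e < p%:Z by rewrite ltz_pmod // ltz_nat prime_gt0.
  have eE : e = `|e|%N by rewrite gez0_abs // modz_ge0.
  exists (`|e|%N%:R).
    by apply: map_f; rewrite mem_iota /= add0n -ltz_nat -eE.
  exists ((q * d%:Z - n * u%:Z)%:~R / d%:R); first by exists (q * d%:Z - n * u%:Z), d.
  have : (n * (1 + u * p)%N%:Z)%:~R = ((q * p%:Z + `|e|%N%:Z) * d%:Z)%:~R :> rat.
    by rewrite wE -eE -qE PoszM mulrA.
  rewrite rmorphB /= !intrM rmorphD /= intrM -!pmulrn natrD natrM => E.
  apply: (mulIf d0); rewrite divfK // mulrDl mulrA divfK //.
  by apply/eqP; rewrite -subr_eq0; apply/eqP; rewrite -[RHS](subrr (n%:~R * (1 + u%:R * p%:R))) {2}E; ring.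
- move=> s sS s0.
  have sM : (`|numq s| + `|denq s| < p)%N.
    apply: leq_ltn_trans pM; rewrite /M (big_rem s) //= -addnA leq_addr //.
  have dn : (0 < `|denq s|)%N by rewrite absz_gt0 denq_neq0.
  have nn : (0 < `|numq s|)%N by rewrite absz_gt0 numq_eq0.
  have cop k : (0 < k)%N -> (k < p)%N -> coprime k p.
    move=> k0 kp; rewrite coprime_sym prime_coprime //.
    by apply: contraTN kp => /(dvdn_leq k0); rewrite -leqNgt.
  have sE : s = (numq s)%:~R / `|denq s|%N%:R.
    by rewrite -{1}(divq_num_den s) pmulrn absz_denq.
  split.
    by exists (numq s), `|denq s|%N => //; apply: cop => //; lia.
  (* Denominators in [A] are natural numbers, so the sign of the numerator of [s] moves to the
     numerator of [s^-1]. *)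
  exists (sgz (numq s) * denq s), `|numq s|%N; first by apply: cop => //; lia.
  have nE : (numq s)%:~R = (sgz (numq s))%:~R * `|numq s|%N%:R :> rat.
    by rewrite {1}[numq s]intEsg rmorphM.
  have sg0 : (sgz (numq s))%:~R * (sgz (numq s))%:~R = 1 :> rat.
    by rewrite -intrM mulz_sg numq_eq0 s0.
  have sgV : (sgz (numq s))%:~R^-1 = (sgz (numq s))%:~R :> rat.
    have sg1 : (sgz (numq s))%:~R != 0 :> rat.
      by apply: contraNneq (oner_neq0 rat) => e; rewrite -sg0 e mulr0.
    by apply: (mulIf sg1); rewrite mulVf ?sg0.
  by rewrite -{1}(divq_num_den s) invf_div nE invfM sgV intrM; ring.
Qed.

(** Everything is read off coordinates in a basis. The frame of [F] is chosen for the coordinates of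
    1, of [S] and its inverses, and of the products of basis vectors; the latter make the new sets
    closed under multiplication. *)
Lemma framed_fieldExt (F : fieldType) (L : fieldExtType F) : framed F -> framed L.
Proof.
move=> frF S; pose e := vbasis (fullv : {vspace L}); set n := \dim (fullv : {vspace L}) in e *.
have xE (x : L) : x = \sum_(i < n) coord e i x *: e`_i.
  by rewrite [LHS](coord_vbasis (memvf x)).
pose Q : seq L := 1 :: S ++ [seq s^-1 | s <- S] ++ [seq e`_ij.1 * e`_ij.2 | ij : 'I_n * 'I_n].
have [p [A [A0 [reps fr]]]] := frF [seq coord e i x | x <- Q, i <- enum 'I_n].
have sA := frame_subring fr; have sA0 := frame_subring0 fr.
have A0Q x i : x \in Q -> A0 (coord e i x).
  move=> xQ; have [->|c0] := eqVneq (coord e i x) 0; first exact: subring0.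
  apply: (frame_unit fr _ c0).1; apply/allpairsP; exists (x, i); split=> //.
  by rewrite mem_enum.
have coordM x y k : coord e k (x * y) =
    \sum_i \sum_j coord e i x * (coord e j y * coord e k (e`_i * e`_j)).
  rewrite {1}(xE x) {1}(xE y) mulr_suml linear_sum; apply: eq_bigr => i _.
  rewrite mulr_sumr linear_sum; apply: eq_bigr => j _.
  by rewrite -scalerAl -scalerAr !linearZ.
have coordp m x i : coord e i (m%:R * x) = m%:R * coord e i x.
  by rewrite !mulr_natl linearMn.
have liftS (B : F -> Prop) : subring B -> (forall x i, x \in Q -> B (coord e i x)) ->
    subring (fun x => forall i, B (coord e i x)).
  move=> sB BQ; split=> [i|x y Bx By i|x y Bx By i].
  - by apply: BQ; rewrite inE eqxx.
  - by rewrite linearB; apply: (subringB sB); [apply: Bx|apply: By].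
  - rewrite coordM; apply: subring_sum => // j _; apply: subring_sum => // k _.
    apply: (subringM sB) => //; apply: (subringM sB) => //; apply: BQ.
    rewrite inE !mem_cat; apply/orP; right; apply/orP; right; apply/orP; right.
    by apply/fintype.imageP; exists (j, k).
exists p, (fun x => forall i, A (coord e i x)), (fun x => forall i, A0 (coord e i x)).
exists [seq \sum_i (nth 0 reps (f i)) *: e`_i | f : {ffun 'I_n -> 'I_(size reps)}].
split.
- exact: frame_prime fr.
- exact: frame_gt2 fr.
- by apply: liftS => // x i xQ; apply: (frame_sub fr); apply: A0Q.
- exact: liftS.
- by move=> x A0x i; apply: (frame_sub fr).
- move=> m mp i; have -> : m%:R^-1 = m%:R^-1 *: 1 :> L.
    by rewrite -(rmorph_nat (in_alg L)) -fmorphV.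
  rewrite linearZ; apply: (subringM sA); first exact: (frame_inv fr).
  by apply: (frame_sub fr); apply: A0Q; rewrite inE eqxx.
- move=> a aP; rewrite (xE a) big1 // => i _.
  rewrite (_ : coord e i a = 0) ?scale0r //; apply: (frame_sep fr) => j.
  have [b Ab abE] := aP j; exists (coord e i b) => //.
  by rewrite abE -!natrX coordp.
- move=> x A0x.
  have /choice[h hP] : forall i : 'I_n, exists eb : F * F,
      [/\ eb.1 \in reps, A eb.2 & coord e i x = eb.1 + p%:R * eb.2].
    by move=> i; have [d dr [b Ab E]] := frame_fin fr (A0x i); exists (d, b).
  have hi i : (index (h i).1 reps < size reps)%N by rewrite index_mem; have [] := hP i.
  pose f : {ffun 'I_n -> 'I_(size reps)} := [ffun i => Ordinal (hi i)].
  exists (\sum_i (nth 0 reps (f i)) *: e`_i).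
    by apply/fintype.imageP; exists f.
  exists (\sum_i (h i).2 *: e`_i).
    move=> i; rewrite coord_sum_free; last exact: basis_free (vbasisP _).
    by have [] := hP i.
  rewrite {1}(xE x) mulr_sumr -big_split; apply: eq_bigr => i _ /=.
  have [hr _ ->] := hP i.
  by rewrite ffunE /= nth_index // scalerDl !mulr_natl scalerMnl.
- move=> s sS s0; split=> i; apply: A0Q; rewrite inE !mem_cat; apply/orP; right.
    by rewrite sS.
  by rewrite map_f ?orbT.
Qed.

(* Stated for abstract fields: [field] diverges on [{fraction {poly F}}]. *)
Section FractionIdentities.
Variables (K : fieldType) (x y x' y' z : K).
Hypotheses (y0 : y != 0) (y'0 : y' != 0).

Lemma sub_quotients : x / y - x' / y' = (x * y' - x' * y) / (y * y').
Proof. by field; rewrite y0 y'0. Qed.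

Lemma cross_quotients : x / y = z * (x' / y') -> x * y' = z * (x' * y).
Proof.
by move/(congr1 (fun t => t * y * y')); rewrite divfK // => ->; field.
Qed.

Lemma split_quotient : x / y = z + (x - z * y) / y.
Proof. by field. Qed.

End FractionIdentities.

(** * Frames on a field of rational functions *)

Section Transcendental.
Variable F : fieldType.
Hypothesis ch0 : char_zero F.

Lemma nat_nonroot (q : {poly F}) : q != 0 -> exists k : nat, q.[k%:R] != 0.
Proof.
move=> q0; apply: contrapT => nx.
have rq k : root q k%:R by apply/negPn/negP => rk; apply: nx; exists k; rewrite -rootE.
pose rs : seq F := [seq k%:R | k <- iota 0 (size q)].
have /max_poly_roots : q != 0 by [].
move/(_ rs); rewrite size_map size_iota ltnn => H.
suff: false by []; apply: H; first by apply/allP => _ /mapP[k _ ->].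
by rewrite map_inj_uniq ?iota_uniq //; apply: (char_zero_inj ch0).
Qed.

Lemma fractionP (z : {fraction {poly F}}) :
  exists u w : {poly F}, w != 0 /\ z = tofrac u / tofrac w.
Proof.
elim/quotW: z => r; exists r.1, r.2; have d0 := denom_ratioP r; split=> //.
have dF0 : tofrac r.2 != 0 by rewrite tofrac_eq0.
apply: (mulIf dF0); rewrite divfK //.
unlock FracField.tofrac; rewrite -[LHS]FracField.pi_mul; apply/eqmodP.
rewrite /= FracField.equivfE /FracField.mulf /= !numden_Ratio ?mulr1 ?oner_eq0 ?d0 //.
by rewrite mulrC.
Qed.


Section FrameFraction.
Variables (S : seq F) (p : nat) (A A0 : F -> Prop) (reps : seq F).
Hypothesis fr : padic_frame S p A A0 reps.
Let sA := frame_subring fr.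
Let sA0 := frame_subring0 fr.

Let p_neq0 : p%:R != 0 :> F.
Proof. by rewrite ch0 -lt0n prime_gt0 ?(frame_prime fr). Qed.

Let Ap : A p%:R. Proof. exact: subring_nat. Qed.

(** These polynomials serve as denominators. Numerators in [A0] will be those of [const_mod], which
    have finitely many residues. *)
Definition one_mod (f : {poly F}) := exists2 h, coefs_in A h & f = 1 + p%:R *: h.

Definition const_mod (f : {poly F}) :=
  exists2 a, A0 a & exists2 h, coefs_in A h & f = a%:P + p%:R *: h.

(** Otherwise 1 would be [p] times an element of [A], hence divisible by all powers of [p], against
    separatedness. *)
Lemma one_mod_neq0 f : one_mod f -> f != 0.
Proof.
move=> [h Ah fE]; apply/eqP => f0; have /eqP := oner_neq0 F; apply.
apply: (frame_sep fr) => j.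
have E : 1 = p%:R * - h`_0.
  move: (congr1 (fun q : {poly F} => q`_0) fE).
  rewrite f0 coef0 coefD coef1 coefZ => E0.
  by apply/eqP; rewrite mulrN -addr_eq0 eq_sym; apply/eqP; exact: E0.
exists ((- h`_0) ^+ j); first by apply: subringX => //; apply: subringN.
by rewrite -exprMn -E expr1n.
Qed.

Lemma one_modM f g : one_mod f -> one_mod g -> one_mod (f * g).
Proof.
move=> [h Ah ->] [k Ak ->]; exists (h + k + p%:R *: (h * k)).
  by apply: coefs_inD => //; [apply: coefs_inD | apply: coefs_inZ => //; apply: coefs_inM].
by rewrite !scalerDr -!mul_polyC; ring.
Qed.

Lemma one_mod1 : one_mod 1.
Proof. by exists 0; [apply: coefs_in0 | rewrite scaler0 addr0]. Qed.

Lemma one_mod_coefs f : one_mod f -> coefs_in A f.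
Proof.
move=> [h Ah ->]; apply: coefs_inD => //; last exact: coefs_inZ.
by apply: coefs_inC => //; apply: subring1.
Qed.

Lemma one_mod_const f : one_mod f -> const_mod f.
Proof. by move=> [h Ah ->]; exists 1; [exact: subring1 | exists h]. Qed.

Lemma const_mod_coefs f : const_mod f -> coefs_in A f.
Proof.
move=> [a Aa [h Ah ->]]; apply: coefs_inD => //; last exact: coefs_inZ.
by apply: coefs_inC => //; apply: (frame_sub fr).
Qed.

Lemma const_modB f g : const_mod f -> const_mod g -> const_mod (f - g).
Proof.
move=> [a Aa [h Ah ->]] [b Ab [k Ak ->]]; exists (a - b); first exact: (subringB sA0).
exists (h - k); first exact: coefs_inB.
by rewrite polyCB scalerBr; ring.
Qed.

Lemma const_modM f g : const_mod f -> const_mod g -> const_mod (f * g).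
Proof.
move=> cf cg; have := const_mod_coefs cf; have := const_mod_coefs cg.
move: cf cg => [a Aa [h Ah ->]] [b Ab [k Ak ->]] Ag Af.
exists (a * b); first exact: (subringM sA0).
exists (h * (b%:P + p%:R *: k) + a *: k).
  apply: coefs_inD => //; first exact: coefs_inM.
  by apply: coefs_inZ => //; apply: (frame_sub fr).
by rewrite polyCM -!mul_polyC; ring.
Qed.

(** A finite geometric series replaces the inverse of [g]: with [g = 1 - x] and [x] divisible by
    [p], [f = f * (1 - x ^+ j) + f * x ^+ j], where [g] divides [1 - x ^+ j] and [p ^ j] divides
    [x ^+ j]. *)
Lemma one_mod_cancel (j : nat) f g : coefs_in A f -> one_mod g ->
  (exists2 k, coefs_in A k & f * g = p%:R ^+ j *: k) ->
  exists2 k, coefs_in A k & f = p%:R ^+ j *: k.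
Proof.
move=> Af [h Ah ->] [k Ak E]; pose x := - (p%:R *: h).
have Ax : coefs_in A x.
  by move=> i; rewrite coefN coefZ; apply: subringN => //; apply: (subringM sA).
have AX i q : coefs_in A q -> coefs_in A (q ^+ i).
  move=> Aq; elim: i => [|i IH].
    by rewrite expr0; apply: coefs_inC => //; apply: subring1.
  by rewrite exprS; apply: coefs_inM.
have AN q : coefs_in A q -> coefs_in A (- q).
  by move=> Aq i; rewrite coefN; apply: subringN.
exists (k * (\sum_(i < j) x ^+ i) + f * (- h) ^+ j).
  apply: coefs_inD => //; apply: coefs_inM => //; last exact/AX/AN.
  by apply: coefs_in_sum => // i _; apply: AX.
have geo : (1 + p%:R *: h) * (\sum_(i < j) x ^+ i) = 1 - x ^+ j.
  have -> : 1 + p%:R *: h = 1 - x by rewrite /x opprK.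
  by rewrite -[RHS]opprB subrX1 -mulNr opprB.
rewrite scalerDr scalerAl -E -mulrA geo scalerAr.
rewrite (_ : p%:R ^+ j *: (- h) ^+ j = x ^+ j); last by rewrite /x -scalerN exprZn.
by ring.
Qed.

Variable c : F.

(* the substitution x = c + p y *)
Definition subst_py (f : {poly F}) := f \Po (p%:R *: 'X + c%:P).

Lemma subst_pyB f g : subst_py (f - g) = subst_py f - subst_py g.
Proof. exact: comp_polyB. Qed.
Lemma subst_pyM f g : subst_py (f * g) = subst_py f * subst_py g.
Proof. exact: comp_polyM. Qed.
Lemma subst_pyC a : subst_py a%:P = a%:P.
Proof. exact: comp_polyC. Qed.
Lemma subst_pyZ a f : subst_py (a *: f) = a *: subst_py f.
Proof. exact: comp_polyZ. Qed.

Lemma subst_py_eq0 f : (subst_py f == 0) = (f == 0).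
Proof.
apply: comp_poly2_eq0; rewrite size_polyDl size_scale ?size_polyX //.
exact: leq_ltn_trans (size_polyC_leq1 _) _.
Qed.

Lemma coef_subst_py f j : (subst_py f)`_j = p%:R ^+ j * (f \Po ('X + c%:P))`_j.
Proof.
rewrite /subst_py; have -> : p%:R *: 'X + c%:P = ('X + c%:P) \Po (p%:R *: 'X) :> {poly F}.
  by rewrite comp_polyD comp_polyX comp_polyC.
rewrite comp_polyA; move: (f \Po _) => g.
rewrite comp_polyE coef_sum.
rewrite (eq_bigr (fun i : 'I_(size g) => if (i == j :> nat) then p%:R ^+ j * g`_j else 0)).
  rewrite -big_mkcond /=; case: (ltnP j (size g)) => [lt|le].
    by rewrite (big_pred1 (Ordinal lt)).
  rewrite nth_default // mulr0 big_pred0 // => i.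
  by apply/negbTE; rewrite neq_ltn (leq_trans (ltn_ord i)).
move=> i _; rewrite exprZn coefZ coefZ coefXn eq_sym.
by case: eqP => [->|]; rewrite ?mulr1 ?mulr0 // mulrC.
Qed.

Definition frac_in (N : {poly F} -> Prop) (z : {fraction {poly F}}) :=
  exists2 u, N (subst_py u) & exists2 w, one_mod (subst_py w) & z = tofrac u / tofrac w.

Lemma one_mod_tofrac w : one_mod (subst_py w) -> tofrac w != 0.
Proof. by move/one_mod_neq0; rewrite subst_py_eq0 tofrac_eq0. Qed.

Lemma frac_in_subring (N : {poly F} -> Prop) :
  (forall f, one_mod f -> N f) -> (forall f g, N f -> N g -> N (f - g)) ->
  (forall f g, N f -> N g -> N (f * g)) -> subring (frac_in N).
Proof.
move=> N1 NB NM; have o1 : one_mod (subst_py 1) by rewrite subst_pyC; apply: one_mod1.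
split.
- by exists 1; [apply: N1 | exists 1; rewrite ?divr1 ?tofrac1].
- move=> _ _ [u Nu [w ow ->]] [u' Nu' [w' ow' ->]].
  have w0 := one_mod_tofrac ow; have w'0 := one_mod_tofrac ow'.
  exists (u * w' - u' * w).
    by rewrite subst_pyB !subst_pyM; apply: NB; apply: NM => //; apply: N1.
  exists (w * w'); first by rewrite subst_pyM; apply: one_modM.
  by rewrite tofracB !tofracM (sub_quotients _ _ w0 w'0).
- move=> _ _ [u Nu [w ow ->]] [u' Nu' [w' ow' ->]].
  exists (u * u'); first by rewrite subst_pyM; apply: NM.
  exists (w * w'); first by rewrite subst_pyM; apply: one_modM.
  by rewrite !tofracM invfM mulrACA.
Qed.

Lemma natr_tofrac (m : nat) : m%:R = tofrac (m%:R%:P : {poly F}).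
Proof. by rewrite polyC_natr rmorph_nat. Qed.

(* Modulo p, f(c + p y) is the constant f(c), a unit of A0: this is why the residues
   stay finite although y is transcendental. *)
Lemma frac_frame (T : seq {fraction {poly F}}) (P : seq {poly F}) :
  (forall f, f \in P -> f.[c] != 0) ->
  (forall f, f \in P -> {subset (f \Po ('X + c%:P) : seq F) <= S}) ->
  (forall z, z \in T -> z != 0 ->
     exists u w, [/\ u \in P, w \in P & z = tofrac u / tofrac w]) ->
  exists reps', padic_frame T p (frac_in (coefs_in A)) (frac_in const_mod) reps'.
Proof.
move=> Pc PS TP; exists [seq tofrac e%:P | e <- reps].
have o1 : one_mod (subst_py 1) by rewrite subst_pyC; apply: one_mod1.
split.
- exact: frame_prime fr.
- exact: frame_gt2 fr.
- by apply: frac_in_subring => *; [exact: one_mod_coefs | exact: coefs_inB | exact: coefs_inM].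
- by apply: frac_in_subring => *; [exact: one_mod_const | exact: const_modB | exact: const_modM].
- by move=> _ [u Nu [w ow ->]]; exists u; [exact: const_mod_coefs | exists w].
- move=> m mp; exists (m%:R^-1)%:P.
    by rewrite subst_pyC; apply: coefs_inC => //; apply: (frame_inv fr).
  exists 1 => //; rewrite tofrac1 divr1.
  have m0 : m%:R != 0 :> F.
    rewrite ch0; apply: contraTneq mp => ->; rewrite /coprime gcd0n.
    by have := frame_gt2 fr; case: (p) => [|[|]].
  have m1 : m%:R != 0 :> {fraction {poly F}} by rewrite natr_tofrac tofrac_eq0 polyC_eq0.
  by apply: (mulfI m1); rewrite divff // natr_tofrac -tofracM -polyCM divff // tofrac1.
- move=> a aP; have [u Au [w ow aE]] : frac_in (coefs_in A) a.
    by have [b Ab ->] := aP 0%N; rewrite expr0 mul1r.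
  have w0 := one_mod_tofrac ow.
  suff u0 : subst_py u = 0.
    by move/eqP: u0; rewrite subst_py_eq0 => /eqP u0; rewrite aE u0 tofrac0 mul0r.
  apply/polyP => i; rewrite coef0; apply: (frame_sep fr) => j.
  have [_ [u' Au' [w' ow' ->]] aE'] := aP j; have w'0 := one_mod_tofrac ow'.
  (* Clearing denominators reduces separatedness to coefficients: the factor [w'] is 1 modulo [p]
     and can be cancelled. *)
  have E : u * w' = p%:R ^+ j *: (u' * w).
    apply/eqP; rewrite -tofrac_eq -mul_polyC !tofracM polyC_exp tofracXn -natr_tofrac; apply/eqP.
    by have := aE'; rewrite aE => /(cross_quotients w0 w'0) ->.
  have [|k Ak ->] := @one_mod_cancel j _ _ Au ow'.
    exists (subst_py (u' * w)); last by rewrite -subst_pyM E subst_pyZ.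
    by rewrite subst_pyM; apply: coefs_inM => //; apply: one_mod_coefs.
  by exists k`_i; rewrite ?coefZ.
- move=> _ [u [a A0a [h Ah uE]] [w [k Ak wE] ->]].
  have ow : one_mod (subst_py w) by exists k.
  have w0 := one_mod_tofrac ow.
  have [e er [b Ab aE]] := frame_fin fr A0a.
  have Ae : A e.
    have -> : e = a - p%:R * b by rewrite aE addrK.
    by apply: (subringB sA); [apply: (frame_sub fr) | apply: (subringM sA)].
  exists (tofrac e%:P); first exact: map_f.
  (* Modulo [p] the numerator [u] is the constant [a], hence [e], and [w] is 1; so [u - e w] is
     divisible by [p]. *)
  exists (tofrac (p%:R^-1 *: (u - e%:P * w)) / tofrac w).
    exists (p%:R^-1 *: (u - e%:P * w)); last by exists w.
    rewrite subst_pyZ subst_pyB subst_pyM subst_pyC uE wE.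
    rewrite (_ : _ - _ = p%:R *: (b%:P + h - e *: k)); last first.
      by rewrite aE polyCD polyCM -!mul_polyC; ring.
    rewrite scalerA mulVf // scale1r; apply: coefs_inB => //; last exact: coefs_inZ.
    by apply: coefs_inD => //; apply: coefs_inC.
  have pE (v : {poly F}) : p%:R * tofrac (p%:R^-1 *: v) = tofrac v.
    by rewrite natr_tofrac -tofracM mul_polyC scalerA mulfV // scale1r.
  rewrite mulrA pE.
  by rewrite tofracB tofracM -(split_quotient _ _ w0).
- suff H u w : u \in P -> w \in P -> frac_in const_mod (tofrac u / tofrac w).
    move=> z zT z0; have [u [w [uP wP ->]]] := TP z zT z0.
    by split; [|rewrite invf_div]; apply: H.
  have unitP f : f \in P -> exists2 h, coefs_in A h & [/\ A0 f.[c], A0 f.[c]^-1 &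
      subst_py f = f.[c]%:P + p%:R *: h].
    move=> fP; pose q := f \Po ('X + c%:P).
    have q0 : q`_0 = f.[c].
      by rewrite -horner_coef0 horner_comp hornerD hornerX hornerC add0r.
    have Aq i : A0 q`_i.
      have [lt|le] := ltnP i (size q); last by rewrite nth_default //; apply: subring0.
      have [->|qi] := eqVneq q`_i 0; first exact: subring0.
      by apply: (frame_unit fr _ qi).1; apply: (PS f fP); apply: mem_nth.
    have q00 : q`_0 != 0 by rewrite q0 Pc.
    have lt0 : (0 < size q)%N by rewrite lt0n; apply: contraNneq q00 => s0; rewrite nth_default ?s0.
    exists (\poly_(i < size q) (if i is j.+1 then p%:R ^+ j * q`_i else 0)).
      move=> i; rewrite coef_poly; case: ifP => _; last exact: subring0.
      case: i => [|i]; first exact: subring0.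
      by apply: (subringM sA); [apply: subringX | apply: (frame_sub fr)].
    split.
    - by rewrite -q0.
    - by rewrite -q0; apply: (frame_unit fr _ q00).2; apply: (PS f fP); apply: mem_nth.
    apply/polyP => i; rewrite coef_subst_py -/q coefD coefC coefZ coef_poly.
    case: i => [|i] /=; first by rewrite lt0 expr0 mul1r q0 mulr0 addr0.
    rewrite add0r; case: ifP => [_|/negbT]; first by rewrite exprS mulrA.
    by rewrite -leqNgt => le; rewrite nth_default ?mulr0.
  move=> uP wP; have [h Ah [A0u A0uV uE]] := unitP u uP.
  have [k Ak [A0w A0wV wE]] := unitP w wP; have wc := Pc w wP.
  (* Dividing numerator and denominator by [w(c)] makes the denominator 1 modulo [p]. *)
  exists (w.[c]^-1 *: u).
    rewrite subst_pyZ uE; exists (w.[c]^-1 * u.[c]); first exact: (subringM sA0).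
    exists (w.[c]^-1 *: h); first by apply: coefs_inZ => //; apply: (frame_sub fr).
    by rewrite polyCM -!mul_polyC; ring.
  exists (w.[c]^-1 *: w).
    rewrite subst_pyZ wE; exists (w.[c]^-1 *: k).
      by apply: coefs_inZ => //; apply: (frame_sub fr).
    by rewrite scalerDr -[X in _ = X + _](_ : w.[c]^-1 *: w.[c]%:P = 1) -?mul_polyC -?polyCM ?mulVf //; ring.
  rewrite -!mul_polyC !tofracM invfM mulrACA divff ?mul1r //.
  by rewrite tofrac_eq0 polyC_eq0 invr_eq0.
Qed.

End FrameFraction.

(** The centre [c] is a natural number at which no nonzero numerator or denominator vanishes; the
    frame of [F] is chosen for their Taylor coefficients at [c]. *)
Lemma framed_fraction : framed F -> framed {fraction {poly F}}.
Proof.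
move=> frF T.
have /choice[uw uwP] : forall z : {fraction {poly F}}, exists uw : {poly F} * {poly F},
    uw.2 != 0 /\ z = tofrac uw.1 / tofrac uw.2.
  by move=> z; have [u [w uwP]] := fractionP z; exists (u, w).
pose P := [seq f <- [seq (uw z).1 | z <- T] ++ [seq (uw z).2 | z <- T] | f != 0].
have [k kP] : exists k : nat, (\prod_(f <- P) f).[k%:R] != 0.
  apply: nat_nonroot; rewrite prodf_seq_neq0; apply/allP => f.
  by rewrite mem_filter => /andP[].
have Pc f : f \in P -> f.[k%:R] != 0.
  by move=> fP; move: kP; rewrite horner_prod prodf_seq_neq0 => /allP/(_ _ fP).
have [p [A [A0 [reps fr]]]] := frF (flatten [seq (f \Po ('X + k%:R%:P) : seq F) | f <- P]).
have [||reps' fr'] := @frac_frame _ _ _ _ _ fr k%:R T P Pc; last 1 first.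
- by exists p; do 2 eexists; exists reps'; exact: fr'.
- move=> f fP x xf; apply/flattenP; exists (f \Po ('X + k%:R%:P) : seq F) => //.
  by apply/mapP; exists f.
move=> z zT z0; have [w0 zE] := uwP z; exists (uw z).1, (uw z).2; split=> //.
  rewrite mem_filter mem_cat (map_f (fun z => (uw z).1) zT) andbT.
  by apply: contraNneq z0 => u0; rewrite zE u0 tofrac0 mul0r.
by rewrite mem_filter mem_cat (map_f (fun z => (uw z).2) zT) orbT w0.
Qed.

End Transcendental.

(** * Subfields generated by finitely many numbers *)

Section Generated.
Variable C : numFieldType.

Lemma char_zero_sub (F : fieldType) (iota : {rmorphism F -> C}) : char_zero F.
Proof. by move=> n; rewrite -(fmorph_eq0 iota) rmorph_nat pnatr_eq0. Qed.

(** Evaluation at a transcendental [y] kills no nonzero denominator, so it extends to fractions. *)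
Lemma fraction_embedding (F : fieldType) (iota : {rmorphism F -> C}) (y : C) :
  (forall q : {poly F}, root (map_poly iota q) y -> q = 0) ->
  exists j : {rmorphism {fraction {poly F}} -> C},
    forall u w, w != 0 -> j (tofrac u / tofrac w) = (map_poly iota u).[y] / (map_poly iota w).[y].
Proof.
move=> tr; pose ev u := (map_poly iota u).[y].
have ev0 w : w != 0 -> ev w != 0 by apply: contraNneq => /rootP/tr ->.
have evM u w : ev (u * w) = ev u * ev w by rewrite /ev rmorphM hornerM.
have evB u w : ev (u - w) = ev u - ev w by rewrite /ev rmorphB hornerD hornerN.
have ev1 : ev 1 = 1 by rewrite /ev rmorph1 hornerC.
have /choice[j jP] : forall z : {fraction {poly F}}, exists v : C,
    forall u w, w != 0 -> z = tofrac u / tofrac w -> v = ev u / ev w.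
  move=> z; have [u0 [w0 [w00 zE]]] := fractionP z; exists (ev u0 / ev w0) => u w wn zE'.
  apply/eqP; rewrite eqr_div ?ev0 // -!evM; apply/eqP; congr ev; apply/eqP.
  by rewrite -tofrac_eq !tofracM -eqr_div ?tofrac_eq0 // -zE zE'.
have jB : zmod_morphism j.
  move=> x z; have [u [w [w0 xE]]] := fractionP x; have [u' [w' [w'0 zE]]] := fractionP z.
  rewrite (jP _ _ _ w0 xE) (jP _ _ _ w'0 zE) (jP _ (u * w' - u' * w) (w * w')) ?mulf_neq0 //.
    by have := ev0 _ w0; have := ev0 _ w'0 => a b; rewrite evB !evM; field; rewrite a b.
  by rewrite xE zE tofracB !tofracM sub_quotients ?tofrac_eq0.
have jM : monoid_morphism j.
  split; first by rewrite (jP _ 1 1) ?oner_neq0 ?tofrac1 ?divr1 // ev1 divr1.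
  move=> x z; have [u [w [w0 xE]]] := fractionP x; have [u' [w' [w'0 zE]]] := fractionP z.
  rewrite (jP _ _ _ w0 xE) (jP _ _ _ w'0 zE) (jP _ (u * u') (w * w')) ?mulf_neq0 //.
    by rewrite !evM invfM mulrACA.
  by rewrite xE zE !tofracM invfM mulrACA.
pose j1 := GRing.isZmodMorphism.Build _ _ j jB.
pose j2 := GRing.isMonoidMorphism.Build _ _ j jM.
pose J : {rmorphism {fraction {poly F}} -> C} := HB.pack j j1 j2.
by exists J => u w w0; apply: jP.
Qed.

(** [L] plays the role of [F(y)]: a rational function field if [y] is transcendental over [F], a
    finite extension otherwise. *)
Lemma framed_adjoin (F : fieldType) (iota : {rmorphism F -> C}) (y : C) : framed F ->
  exists (L : fieldType) (j : {rmorphism L -> C}),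
    [/\ framed L, forall x, exists z, j z = iota x & exists z, j z = y].
Proof.
move=> frF; have chF := char_zero_sub iota.
have [tr|] := pselect (forall q : {poly F}, root (map_poly iota q) y -> q = 0).
  have [j jE] := fraction_embedding tr; exists {fraction {poly F}}, j; split.
  - exact: framed_fraction.
  - move=> x; exists (tofrac x%:P / tofrac 1).
    by rewrite jE ?oner_neq0 // map_polyC hornerC rmorph1 hornerC divr1.
  - exists (tofrac 'X / tofrac 1).
    by rewrite jE ?oner_neq0 // map_polyX hornerX rmorph1 hornerC divr1.
move=> /existsNP[q0 /not_implyP[rq0 /eqP q00]].
(* A nonzero polynomial of least size vanishing at [y] is irreducible. *)
have ex : exists n, `[< exists q : {poly F}, [/\ q != 0, root (map_poly iota q) y & size q = n] >].
  by exists (size q0); apply/asboolP; exists q0.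
case: (ex_minnP ex) => _ /asboolP[q [qn0 rq <-]] qmin.
have irr : irreducible_poly q.
  apply/(subfx_irreducibleP rq qn0) => r rr rn0; apply: qmin; apply/asboolP.
  by exists r.
have frL : framed (SubFieldExtType rq irr) := framed_fieldExt (L := SubFieldExtType rq irr) frF.
exists (SubFieldExtType rq irr), (subfx_inj : {rmorphism (SubFieldExtType rq irr) -> C}); split=> //.
- move=> x; exists (inj_subfx iota y q x).
  by rewrite /= subfx_inj_eval // map_polyC hornerC.
- by exists (subfx_root iota y q); rewrite /= subfx_inj_root.
Qed.

Lemma framed_generated (S : seq C) : exists (F : fieldType) (iota : {rmorphism F -> C}),
  framed F /\ forall s, s \in S -> exists z, iota z = s.
Proof.
elim: S => [|y S [F [iota [frF IH]]]].
  by exists rat, (ratr : {rmorphism rat -> C}); split=> //; apply: framed_rat.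
have [L [j [frL jF [z zy]]]] := framed_adjoin iota y frF.
exists L, j; split=> // s /[!inE] /predU1P[->|/IH[x <-]]; first by exists z.
exact: jF.
Qed.

Theorem skolem_mahler_lech (I : finType) (c a : I -> C) :
  (forall i, a i != 0) -> (forall N, exists2 m, (N <= m)%N & \sum_i c i * a i ^+ m = 0) ->
  exists2 T, (0 < T)%N & exists r, forall k, \sum_i c i * a i ^+ (r + T * k) = 0.
Proof.
move=> a0 zeros; have [F [iota [frF iotaS]]] := framed_generated (codom c ++ codom a).
have /choice[c' c'E] : forall i, exists z, iota z = c i.
  by move=> i; apply: iotaS; rewrite mem_cat codom_f.
have /choice[a' a'E] : forall i, exists z, iota z = a i.
  by move=> i; apply: iotaS; rewrite mem_cat codom_f orbT.
have a'0 i : a' i != 0 by rewrite -(fmorph_eq0 iota) a'E.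
have [T T0 sml] := framed_skolem_mahler_lech (char_zero_sub iota) frF c' a'0.
have fE m : iota (\sum_i c' i * a' i ^+ m) = \sum_i c i * a i ^+ m.
  by rewrite rmorph_sum; apply: eq_bigr => i _; rewrite rmorphM rmorphXn c'E a'E.
exists T => //.
(* Pigeonhole: if each class modulo [T] had only boundedly many zeros, so would the whole sum. *)
have [r rP] : exists r, forall N, exists2 k, (N <= k)%N & \sum_i c i * a i ^+ (r + T * k) = 0.
  apply: contrapT => /forallNP nr.
  have /choice[B BP] : forall r, exists N, forall k, (N <= k)%N -> \sum_i c i * a i ^+ (r + T * k) <> 0.
    move=> r; have /existsNP[N NP] := nr r; exists N => k Nk E; apply: NP; exists k => //.
  have [m mN mE] := zeros (T * (\max_(r < T) B r).+1)%N.
  have mT : (m %% T < T)%N by rewrite ltn_mod.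
  apply: (BP (m %% T)%N (m %/ T)%N); last by rewrite mulnC addnC -divn_eq.
  apply: (leq_trans (leq_bigmax (F := fun r : 'I_T => B r) (Ordinal mT))).
  by rewrite leq_divRL // mulnC; apply: leq_trans mN; rewrite leq_mul2l leqnSn orbT.
exists r => k; rewrite -fE sml ?rmorph0 // => N.
have [i Ni E] := rP N; exists i => //.
by apply: (fmorph_inj iota); rewrite fE rmorph0.
Qed.

End Generated.

(** * Systems twisted by powers *)

(** The relations are combined with the coefficients of a polynomial vanishing at all nodes except
    [z i0]. The other nodes may coincide among themselves. *)
Lemma exponential_sum_coef (K : fieldType) (I : finType) (c z : I -> K) (i0 : I) :
  (forall i, z i = z i0 -> i = i0) -> (forall k, \sum_i c i * z i ^+ k = 0) -> c i0 = 0.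
Proof.
move=> zi0 E; pose Q := \prod_(i | i != i0) ('X - (z i)%:P).
have : \sum_i c i * Q.[z i] = 0.
  transitivity (\sum_(k < size Q) Q`_k * \sum_i c i * z i ^+ k).
    under eq_bigr => i _ do rewrite horner_coef mulr_sumr.
    rewrite exchange_big; apply: eq_bigr => k _; rewrite mulr_sumr.
    by apply: eq_bigr => i _; rewrite mulrCA.
  by rewrite big1 // => k _; rewrite E mulr0.
rewrite (bigD1 i0) //= big1 ?addr0 => [/eqP|i ii0]; last first.
  by rewrite horner_prod (bigD1 i) //= hornerXsubC subrr mul0r mulr0.
rewrite mulf_eq0 => /orP[/eqP//|]; rewrite horner_prod prodf_seq_eq0 => /hasP[i _].
by rewrite hornerXsubC subr_eq0 => /andP[ii0 /eqP/esym/zi0 e]; rewrite e eqxx in ii0.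
Qed.

(** * A subproduct whose powers occur only once *)

Section Signs.
Variable K : fieldType.

Definition spow (e : bool) (x : K) := if e then x else x^-1.

(* The convex cone spanned by suitable signs of elements of infinite order is pointed. *)
Lemma pointed_signs (beta : nat -> K) n :
  (forall i, beta i != 0) -> (forall i, ~ is_root_of_unity (beta i)) ->
  exists f : nat -> bool, forall e : nat -> nat,
    \prod_(i < n) spow (f i) (beta i) ^+ e i = 1 -> forall i, (i < n)%N -> e i = 0%N.
Proof.
move=> b0 bnt; elim: n => [|n [f fP]]; first by exists xpredT.
pose ext (eps : bool) i := if i == n then eps else f i.
have extE eps (e : nat -> nat) : \prod_(i < n.+1) spow (ext eps i) (beta i) ^+ e i =
    \prod_(i < n) spow (f i) (beta i) ^+ e i * spow eps (beta n) ^+ e n.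
  rewrite big_ord_recr /= {2}/ext eqxx; congr (_ * _); apply: eq_bigr => i _.
  by rewrite /ext ltn_eqF.
(* If both signs of [beta n] fail, there are relations involving [beta n] and its inverse with
   positive exponents. *)
apply: contrapT => /forallNP nf.
have bad eps : exists e : nat -> nat, (0 < e n)%N /\
    \prod_(i < n) spow (f i) (beta i) ^+ e i * spow eps (beta n) ^+ e n = 1.
  have /existsNP[e /not_implyP[E ne]] := nf (ext eps); exists e; rewrite extE in E.
  split=> //; rewrite lt0n; apply/eqP => en0; apply: ne => i; rewrite ltnS leq_eqVlt.
  by rewrite en0 expr0 mulr1 in E; case/orP=> [/eqP-> // | ]; apply: fP.
have [e [en0 eE]] := bad true; have [e' [e'n0 e'E]] := bad false.
(* These weights cancel [beta n] between the two relations. By induction the other exponents vanish,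
   and [beta n] would be a root of unity. *)
pose e2 i := (e' n * e i + e n * e' i)%N.
have e20 : \prod_(i < n) spow (f i) (beta i) ^+ e2 i = 1.
  have := congr1 (fun x => x ^+ e' n) eE; have := congr1 (fun x => x ^+ e n) e'E.
  rewrite !expr1n !exprMn /spow -!exprM => E' E.
  have nz : beta n ^+ (e n * e' n) != 0 by rewrite expf_neq0.
  rewrite exprVn mulnC in E'.
  have := congr2 *%R E E'; rewrite mulrACA divff // !mulr1 => EE'.
  rewrite -[RHS]EE' -!prodrXl -big_split /=.
  by apply: eq_bigr => i _; rewrite -!exprM -exprD /e2 (mulnC (e' n)) (mulnC (e n)).
have e0 i : (i < n)%N -> e i = 0%N.
  by move=> /(fP _ e20)/eqP; rewrite addn_eq0 muln_eq0 => /andP[/orP[]/eqP]; lia.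
apply: (bnt n); exists (e n) => //; rewrite -eE big1 ?mul1r // => i _.
by rewrite e0 ?expr0.
Qed.

(** Take for [f0] the signs of [pointed_signs]. The ratio of the subproducts of [f0] and [f]
    contains [beta i], with the sign prescribed by [f0], exactly where [f] and [f0] differ. *)
Lemma unique_subproduct n (beta : 'I_n -> K) T : (0 < T)%N ->
  (forall i, beta i != 0) -> (forall i, ~ is_root_of_unity (beta i)) ->
  exists f0 : {ffun 'I_n -> bool}, forall f : {ffun 'I_n -> bool},
    (\prod_i (if f i then beta i else 1)) ^+ T = (\prod_i (if f0 i then beta i else 1)) ^+ T ->
    f = f0.
Proof.
case: n beta => [|n] beta T0 b0 bnt.
  by exists [ffun=> true] => f _; apply/ffunP; case.
have [g gP] := @pointed_signs (fun i => beta (inord i)) n.+1 (fun i => b0 _) (fun i => bnt _).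
exists [ffun i => g (val i)] => f E; apply/ffunP => i; rewrite ffunE.
pose e (i : nat) := (T * (f (inord i) != g i))%N.
suff : e i = 0%N.
  move/eqP; rewrite /e muln_eq0 -leqn0 leqNgt T0 /= inord_val eqb0 negbK.
  by move/eqP.
apply: gP (ltn_ord i).
have nz (h : 'I_n.+1 -> bool) : \prod_i (if h i then beta i else 1) != 0.
  by apply/prodf_neq0 => j _; case: (h j); rewrite ?b0 ?oner_neq0.
rewrite (eq_bigr (fun j : 'I_n.+1 => ((if g j then beta j else 1) / (if f j then beta j else 1)) ^+ T)).
  have gE : \prod_j (if [ffun j => g (val j)] j then beta j else 1) =
      \prod_(j < n.+1) (if g j then beta j else 1).
    by apply: eq_bigr => j _; rewrite ffunE.
  by rewrite prodrXl prodf_div expr_div_n E gE divff ?expf_neq0.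
move=> j _; rewrite inord_val /e inord_val /spow.
case: (g j); case: (f j) => /=; rewrite ?muln0 ?muln1 ?expr0 ?divr1 ?mul1r //.
  by rewrite divff ?expr1n.
by rewrite expr1n.
Qed.

End Signs.

(** * Twisted Vandermonde determinants *)

Section TwistedVandermonde.
Variables (K : numFieldType) (s : nat) (b : 'I_s -> K).
Hypotheses (b0 : forall i, b i != 0) (b_inj : injective b).
Hypothesis b_inv : forall i j, b i != (b j)^-1.
Hypothesis b_nt : forall i, ~ is_root_of_unity (b i).

Let node (f : {ffun 'I_s -> bool}) i := if f i then (b i)^-1 else b i.

Let node_inj f : injective (node f).
Proof.
move=> i j; rewrite /node; case: (f i); case: (f j).
- by move/invr_inj/b_inj.
- by move=> e; have := b_inv j i; rewrite e eqxx.
- by move=> e; have := b_inv i j; rewrite e eqxx.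
- by move/b_inj.
Qed.

Let C (f : {ffun 'I_s -> bool}) : K :=
  \prod_i (if f i then -1 else 1) * \det (Vandermonde s (\row_i node f i)).
Let B (f : {ffun 'I_s -> bool}) : K := \prod_i (if f i then b i ^+ 2 else 1).

Let C_neq0 f : C f != 0.
Proof.
rewrite mulf_neq0 //.
  by apply/prodf_neq0 => i _; case: (f i); rewrite ?oppr_eq0 oner_neq0.
rewrite det_Vandermonde; apply/prodf_neq0 => i _; apply/prodf_neq0 => j ij.
rewrite !mxE subr_eq0; apply: contraTneq ij => /node_inj->.
by rewrite ltnn.
Qed.

(** Each row is a difference of two Vandermonde rows; by multilinearity, [f] records which of them
    is taken in each row. *)
Lemma det_twisted_vandermonde m :
  \det (\matrix_(i < s, j < s) (b i ^+ j - b i ^+ (2 * m) * (b i)^-1 ^+ j)) =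
  \sum_(f : {ffun 'I_s -> bool}) C f * B f ^+ m.
Proof.
pose d (i : 'I_s) (e : bool) : K := if e then - (b i ^+ 2) ^+ m else 1.
pose y (i : 'I_s) (e : bool) : K := if e then (b i)^-1 else b i.
transitivity (\sum_(f : {ffun 'I_s -> bool}) \sum_(sg : 'S_s)
    (-1) ^+ sg * \prod_i (d i (f i) * y i (f i) ^+ sg i)).
  rewrite exchange_big; apply: eq_bigr => sg _; rewrite -mulr_sumr; congr (_ * _).
  rewrite -(bigA_distr_bigA (fun i e => d i e * y i e ^+ sg i)); apply: eq_bigr => i _.
  rewrite !mxE (bigD1 false) //= (bigD1 true) //= big1 ?addr0 => [|[]//].
  by rewrite /d /y mul1r mulNr exprM.
apply: eq_bigr => f _.
have -> : B f ^+ m = \prod_i (if f i then (b i ^+ 2) ^+ m else 1).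
  by rewrite -prodrXl; apply: eq_bigr => i _; case: (f i); rewrite ?expr1n.
rewrite /C mulrAC -big_split /= -det_tr mulr_sumr; apply: eq_bigr => sg _.
rewrite big_split /= mulrCA; congr (_ * _).
  by apply: eq_bigr => i _; rewrite /d; case: (f i); rewrite ?mulN1r ?mulr1.
by congr (_ * _); apply: eq_bigr => i _; rewrite !mxE.
Qed.

(** A nonzero [P] makes the determinant vanish. If this happened for unbounded [m], the determinant
    would vanish on a progression of step [T], although some [B f0 ^+ T] occurs once and has
    coefficient [C f0 != 0]. *)
Theorem twisted_system_trivial : exists N, forall m, (N <= m)%N -> forall P : {poly K},
  (size P <= s)%N -> (forall i, P.[b i] = b i ^+ (2 * m) * P.[(b i)^-1]) -> P = 0.
Proof.
apply: contrapT => /forallNP nN.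
have B0 f : B f != 0.
  by apply/prodf_neq0 => i _; case: (f i); rewrite ?expf_neq0 ?oner_neq0.
have [|T T0 [r rP]] := @skolem_mahler_lech K _ C B B0.
  move=> N; have /existsNP[m /not_implyP[Nm]] := nN N.
  move=> /existsNP[P /not_implyP[sP /not_implyP[PE /eqP P0]]]; exists m => //.
  rewrite -det_twisted_vandermonde -det_tr; apply/eqP/det0P.
  exists (\row_j P`_j); last first.
    apply/rowP => i; rewrite !mxE; have := PE i => /eqP; rewrite -subr_eq0 => /eqP E.
    rewrite -[RHS]E !(horner_coef_wide _ sP) mulr_sumr -sumrB; apply: eq_bigr => j _.
    by rewrite !mxE mulrBr mulrCA.
  apply: contraNneq P0 => v0; apply/eqP/polyP => j; rewrite coef0.
  have [lt|le] := ltnP j s; last by rewrite nth_default // (leq_trans sP).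
  by have := congr1 (fun v : 'rV_s => v 0 (Ordinal lt)) v0; rewrite !mxE.
have b20 i : b i ^+ 2 != 0 by rewrite expf_neq0.
have b2nt i : ~ is_root_of_unity (b i ^+ 2).
  by move=> [k k0 kE]; apply: (@b_nt i); exists (2 * k)%N; rewrite ?muln_gt0 // exprM.
have [f0 f0P] := unique_subproduct T0 b20 b2nt.
have /eqP : C f0 * B f0 ^+ r = 0.
  apply: (@exponential_sum_coef K _ (fun f => C f * B f ^+ r) (fun f => B f ^+ T)) f0P _ => k.
  by rewrite -[RHS](rP k); apply: eq_bigr => f _; rewrite exprD exprM mulrA.
by rewrite mulf_eq0 (negPf (C_neq0 _)) expf_eq0 (negPf (B0 _)) andbF.
Qed.

End TwistedVandermonde.

(** * The reflection x -> 1/x *)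

Section Reversal.
Variable K : numFieldType.

Definition rev_poly r (P : {poly K}) := \poly_(j < r.+1) P`_(r - j).

Lemma horner_rev_poly r (P : {poly K}) x : x != 0 -> (size P <= r.+1)%N ->
  (rev_poly r P).[x] = x ^+ r * P.[x^-1].
Proof.
move=> x0 sP; rewrite horner_poly (horner_coef_wide _ sP) mulr_sumr.
rewrite (reindex_inj rev_ord_inj); apply: eq_bigr => i _ /=.
have ir : (i <= r)%N := ltn_ord i.
rewrite subSS subKn // mulrCA; congr (_ * _).
by rewrite exprVn expfB_cond ?(negPf x0).
Qed.

Lemma reflection_proportional (bs : seq K) (u : K -> K) (P Q : {poly K}) :
  uniq (bs ++ [seq x^-1 | x <- bs]) -> 0 \notin bs ->
  (size P <= (size bs).+1)%N -> (size Q <= (size bs).+1)%N ->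
  {in bs, forall x, P.[x] = u x * P.[x^-1]} ->
  {in bs, forall x, Q.[x] = u x * Q.[x^-1]} ->
  forall x, x != 0 -> P.[x] * Q.[x^-1] = P.[x^-1] * Q.[x].
Proof.
move=> ubs bs0 sP sQ PE QE; set r := size bs in sP sQ.
pose W := P * rev_poly r Q - rev_poly r P * Q.
have WE x : x != 0 -> W.[x] = x ^+ r * (P.[x] * Q.[x^-1] - P.[x^-1] * Q.[x]).
  by move=> x0; rewrite hornerD hornerN !hornerM !horner_rev_poly //; ring.
suff W0 : W = 0.
  move=> x x0; apply/eqP; rewrite -subr_eq0; have := WE x x0.
  by rewrite W0 horner0 => /esym/eqP; rewrite mulf_eq0 expf_eq0 (negPf x0) andbF.
(* A fixed point of inversion cannot belong to the list, so 1 and -1 are two further zeros of [W]: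
   [2r + 2] in all, against degree at most [2r]. *)
have self x : x = x^-1 -> x \notin bs ++ [seq x^-1 | x <- bs].
  move=> xV; rewrite mem_cat -orbC negb_or andbC.
  have xbs : x \notin bs.
    apply/negP => xb; move: ubs; rewrite cat_uniq => /and3P[_ /hasPn/(_ x^-1) H _].
    by have := H (map_f _ xb); rewrite -xV xb.
  rewrite xbs; apply: contra xbs => /mapP[y yb xy].
  by rewrite xV xy invrK.
have one_neqN1 : 1 != -1 :> K.
  by rewrite -subr_eq0 opprK -[1 + 1]/(2%:R) pnatr_eq0.
apply: (@roots_geq_poly_eq0 _ W (1 :: -1 :: bs ++ [seq x^-1 | x <- bs])).
- have sw x : x != 0 -> P.[x] * Q.[x^-1] = P.[x^-1] * Q.[x] -> root W x.
    by move=> x0 E; apply/rootP; rewrite WE // E subrr mulr0.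
  have nz x : x \in bs -> x != 0 by apply: contraTneq => ->.
  rewrite /= !sw ?invrN ?invr1 ?oppr_eq0 ?oner_eq0 //=.
  rewrite all_cat; apply/andP; split; apply/allP => x.
    by move=> xb; apply: sw; rewrite ?nz // (PE _ xb) (QE _ xb); ring.
  move=> /mapP[y yb ->]; apply: sw; first by rewrite invr_eq0 nz.
  by rewrite invrK (PE _ yb) (QE _ yb); ring.
- rewrite /= inE negb_or one_neqN1 ubs andbT /=; apply/andP; split; apply: self.
    by rewrite invr1.
  by rewrite invrN invr1.
rewrite /= size_cat size_map -/r.
have srev R : (size (rev_poly r R) <= r.+1)%N by apply: size_poly.
have szM (A B : {poly K}) : (size A <= r.+1)%N -> (size B <= r.+1)%N -> (size (A * B)%R <= (r + r).+1)%N.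
  by move=> sA sB; apply: leq_trans (size_polyMleq _ _) _; lia.
apply: leq_trans (size_polyD _ _) _; rewrite size_polyN geq_max.
by rewrite !(leq_trans (szM _ _ _ _)) // ?leqW.
Qed.

End Reversal.

(** * Continued fractions of Laurent series *)

Section LaurentDegree.
Variable K : fieldType.
Implicit Types (f h : laurent K) (p q : {poly K}) (N M : int).

(** Degree at most [N] in [t], that is, order at least [-N] at infinity; [ldeg] is the exact
    degree. *)
Definition lbd N f := lbounded N (lcoef f).

Definition ldeg f N := lcoef f N != 0 /\ lbd N f.

Lemma lbdW N M f : N <= M -> lbd N f -> lbd M f.
Proof. exact: lboundedW. Qed.

Lemma lbdM N M f h : lbd N f -> lbd M h -> lbd (N + M) (f * h).
Proof. exact: lconv_bounded. Qed.

Lemma lbdD N f h : lbd N f -> lbd N h -> lbd N (f + h).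
Proof. by move=> Nf Nh n nN; rewrite lcoefD Nf // Nh // addr0. Qed.

Lemma lbdN N f : lbd N f -> lbd N (- f).
Proof. by move=> Nf n nN; rewrite lcoefN Nf // oppr0. Qed.

Lemma lbdB N f h : lbd N f -> lbd N h -> lbd N (f - h).
Proof. by move=> Nf Nh; apply: lbdD => //; apply: lbdN. Qed.

Lemma lbd0 N : lbd N (0 : laurent K).
Proof. by []. Qed.

Lemma lcoefM_top N M f h : lbd N f -> lbd M h ->
  lcoef (f * h) (N + M) = lcoef f N * lcoef h M.
Proof.
move=> Nf Mh; have := lconvE 0 Nf Mh; rewrite lcoefM subr0 => ->.
by rewrite big_ord_recl big_ord0 addr0 /= !subr0.
Qed.

Lemma ldegM f h N M : ldeg f N -> ldeg h M -> ldeg (f * h) (N + M).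
Proof.
move=> [fN Nf] [hM Mh]; split; last exact: lbdM.
by rewrite lcoefM_top // mulf_neq0.
Qed.

Lemma ldeg_le f N M : ldeg f N -> lbd M f -> N <= M.
Proof. by move=> [fN _] Mf; rewrite leNgt; apply: contraNN fN => /Mf/eqP. Qed.

Lemma ldeg_unique f N M : ldeg f N -> ldeg f M -> N = M.
Proof.
move=> fN fM; apply/eqP; rewrite eq_le; apply/andP; split.
  by apply: ldeg_le fN fM.2.
by apply: ldeg_le fM fN.2.
Qed.

Lemma ldeg_neq0 f N : ldeg f N -> f != 0.
Proof. by move=> [fN _]; apply: contraNneq fN => ->. Qed.

Lemma ldeg_exists f : f != 0 -> exists N, ldeg f N.
Proof. by move=> /laurent_lead[N fN Nf]; exists N. Qed.

Lemma ldegN f N : ldeg f N -> ldeg (- f) N.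
Proof. by move=> [fN Nf]; split; [rewrite lcoefN oppr_eq0 | apply: lbdN]. Qed.

Lemma lcoef_polyL p (k : nat) : lcoef (polyL p) k%:Z = p`_k.
Proof. by []. Qed.

Lemma lbd_polyL p : lbd ((size p)%:Z - 1) (polyL p).
Proof.
move=> [k|k] //= lt; rewrite nth_default //.
by move: lt; move: (size p) => n; lia.
Qed.

(** The maximum covers negative [N], where the polynomial is forced to be 0. *)
Lemma lbd_polyL_size p N : lbd N (polyL p) -> (size p)%:Z <= Num.max (0 : int) (N + 1).
Proof.
move=> Np; suff : (size p <= absz (Num.max (0 : int) (N + 1))%R)%N.
  have : 0 <= Num.max (0 : int) (N + 1) by rewrite le_max lexx.
  by move: (Num.max _ _) => M; lia.
apply/leq_sizeP => k kN; rewrite -lcoef_polyL; apply: Np.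
have : N + 1 <= Num.max (0 : int) (N + 1) by rewrite le_max lexx orbT.
by move: (Num.max _ _) kN => M; lia.
Qed.

Lemma ldeg_polyL p n : size p = n.+1 -> ldeg (polyL p) n%:Z.
Proof.
move=> sp; split; last by have := lbd_polyL (p := p); rewrite sp -addn1 PoszD addrK.
by rewrite lcoef_polyL -[n]/(n.+1.-1) -sp -lead_coefE lead_coef_eq0 -size_poly_eq0 sp.
Qed.

Lemma ldeg1 : ldeg (1 : laurent K) 0.
Proof. by apply: (@ldeg_polyL 1 0); rewrite size_poly1. Qed.

Lemma ldegV f N : ldeg f N -> ldeg f^-1 (- N).
Proof.
move=> fN; have f0 := ldeg_neq0 fN.
have [M fM] : exists M, ldeg f^-1 M by apply: ldeg_exists; rewrite invr_eq0.
have := ldegM fN fM; rewrite divff // => /(ldeg_unique ldeg1) /eqP.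
by rewrite eq_sym addrC addr_eq0 => /eqP <-.
Qed.

Lemma lbd_divM f h N M : ldeg f N -> lbd M (f * h) -> lbd (M - N) h.
Proof.
move=> fN Mfh; have [->|/ldeg_exists[L hL]] := eqVneq h 0; first exact: lbd0.
by apply: lbdW hL.2; have := ldeg_le (ldegM fN hL) Mfh; lia.
Qed.

Lemma polyL_inj : injective (@polyL K).
Proof.
by move=> p q pq; apply/polyP => k; rewrite -!lcoef_polyL pq.
Qed.

Lemma lbd_sub_lfloor f : lbd (-1) (f - polyL (lfloor f)).
Proof.
move=> [k|k] lt; last by lia.
by rewrite lcoefD lcoefN lcoef_polyL coef_lfloor subrr.
Qed.

Lemma size_lfloor f (n : nat) : ldeg f n%:Z -> size (lfloor f) = n.+1.
Proof.
move=> [fn nf]; apply/eqP; rewrite eqn_leq; apply/andP; split.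
  by apply/leq_sizeP => k kn; rewrite coef_lfloor; apply: nf; lia.
by apply: contraNT fn; rewrite -leqNgt -coef_lfloor => le; rewrite nth_default.
Qed.

Lemma lead_coef_lfloor f (n : nat) : ldeg f n%:Z -> lead_coef (lfloor f) = lcoef f n.
Proof. by move=> fn; rewrite lead_coefE (size_lfloor fn) coef_lfloor. Qed.

Lemma lfloor0 : lfloor (0 : laurent K) = 0.
Proof. by apply/polyP => k; rewrite coef_lfloor coef0. Qed.

End LaurentDegree.

(** * Convergents, approximation errors and Legendre's criterion *)

Section Convergents.
Variables (K : fieldType) (f : laurent K) (e : nat).
Hypotheses (f_deg : ldeg f e%:Z) (e_gt0 : (0 < e)%N).

Local Notation alpha := (cf_alpha f).
Local Notation a := (cf_quot f).
Local Notation p := (cf_num f).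
Local Notation q := (cf_den f).

Definition cf_err n : laurent K := polyL (p n) - polyL (q n) * f.
Local Notation phi := cf_err.

Lemma cf_numSS n : p n.+2 = a n.+1 * p n.+1 + p n. Proof. by []. Qed.
Lemma cf_denSS n : q n.+2 = a n.+1 * q n.+1 + q n. Proof. by []. Qed.

Lemma cf_errSS n : phi n.+2 = polyL (a n.+1) * phi n.+1 + phi n.
Proof. by rewrite /cf_err cf_numSS cf_denSS !rmorphD !rmorphM /=; ring. Qed.

Lemma cf_det n : p n.+1 * q n - q n.+1 * p n = (-1) ^+ n.+1.
Proof.
elim: n => [|n IH]; first by rewrite /= mulr0 mul1r sub0r.
by rewrite cf_numSS cf_denSS exprS -IH; ring.
Qed.

Lemma cf_coprime n : coprimep (p n) (q n).
Proof.
have E := cf_det n; apply/Bezout_coprimepP.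
exists (- (-1) ^+ n.+1 * q n.+1, (-1) ^+ n.+1 * p n.+1) => /=.
suff -> : - (-1) ^+ n.+1 * q n.+1 * p n + (-1) ^+ n.+1 * p n.+1 * q n = 1 by apply: eqpxx.
have -> : - (-1) ^+ n.+1 * q n.+1 * p n + (-1) ^+ n.+1 * p n.+1 * q n =
  (-1) ^+ n.+1 * (p n.+1 * q n - q n.+1 * p n) by ring.
by rewrite E -exprD addnn -signr_odd odd_double expr0.
Qed.

(** With the convention [0^-1 = 0], an expansion that has stopped stays at 0. *)
Lemma cf_alpha_prev n : alpha n.+1 != 0 -> alpha n != 0.
Proof.
apply: contraNneq => /= a0; rewrite a0 lfloor0 /= ?rmorph0 subr0.
by rewrite invr0.
Qed.

Lemma cf_alphaS_deg n : alpha n.+1 != 0 ->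
  exists l, [/\ (0 < l)%N, ldeg (alpha n.+1) l%:Z & size (a n.+1) = l.+1].
Proof.
move=> an0; have [N aN] := ldeg_exists an0.
have := ldegV aN; rewrite /= invrK => /ldeg_le /(_ (@lbd_sub_lfloor _ _)) N1.
have NE : N = (absz N)%:Z by lia.
exists (absz N); split; [lia | by rewrite -NE |].
by apply: size_lfloor; rewrite -NE.
Qed.

(** The engine is [phi n.+1 * alpha n.+1 = - phi n]: each step lowers the degree of the error by
    that of the partial quotient, while the denominator gains the same degree. Thus [phi n] has
    degree [- deg q n.+1]. *)
Lemma cf_invariant n : alpha n.+1 != 0 -> exists Q : nat,
  [/\ (n <= Q)%N,
      size (q n.+1) = Q.+1 /\ size (p n.+1) = (Q + e).+1,
      (size (q n) <= Q)%N /\ (size (p n) <= Q + e)%N,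
      lead_coef (p n.+1) = lead_coef (q n.+1) * lcoef f e &
      phi n.+1 * alpha n.+1 = - phi n /\ ldeg (phi n) (- Q%:Z)].
Proof.
elim: n => [|n IH] an0.
  have sa0 : size (a 0) = e.+1 := size_lfloor f_deg.
  exists 0%N; split=> //.
  - by rewrite /= size_poly1 add0n; split.
  - by rewrite /= size_poly0 size_poly1 add0n; split.
  - by rewrite /= lead_coef1 mul1r; apply: lead_coef_lfloor.
  - split; last by rewrite /cf_err /= !rmorph0 mul0r subr0; apply: ldeg1.
    rewrite /cf_err /= rmorph0 mul0r subr0 mul1r -opprB mulNr mulfV //.
    by move: an0; rewrite /= invr_eq0.
have [Q [nQ [sq sp] [sq' sp'] lpq [phiE phiQ]]] := IH (cf_alpha_prev an0).
have [l [l0 al sal]] := cf_alphaS_deg (cf_alpha_prev an0).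
have a0 : a n.+1 != 0 by rewrite -size_poly_eq0 sal.
have q0 : q n.+1 != 0 by rewrite -size_poly_eq0 sq.
have p0 : p n.+1 != 0 by rewrite -size_poly_eq0 sp.
have saq : size (a n.+1 * q n.+1) = (l + Q).+1 by rewrite size_mul // sal sq addnS.
have sap : size (a n.+1 * p n.+1) = (l + Q + e).+1.
  by rewrite size_mul // sal sp addnS /= addSn addnA.
have ltq : (size (q n) < size (a n.+1 * q n.+1)%R)%N by rewrite saq; lia.
have ltp : (size (p n) < size (a n.+1 * p n.+1)%R)%N by rewrite sap; lia.
exists (l + Q)%N; split.
- by lia.
- by rewrite cf_numSS cf_denSS !size_polyDl // saq sap.
- by rewrite sq sp; split; lia.
- by rewrite cf_numSS cf_denSS !lead_coefDl // !lead_coefM lpq mulrA.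
split.
  have nz : alpha n.+1 - polyL (a n.+1) != 0 by move: an0; rewrite /= invr_eq0.
  have -> : phi n.+2 = - ((alpha n.+1 - polyL (a n.+1)) * phi n.+1).
    by rewrite cf_errSS -[phi n]opprK -phiE; ring.
  have -> : alpha n.+2 = (alpha n.+1 - polyL (a n.+1))^-1 by [].
  by rewrite mulNr mulrAC mulfV // mul1r.
have -> : phi n.+1 = - phi n * (alpha n.+1)^-1 by rewrite -phiE mulfK // cf_alpha_prev.
have -> : - (l + Q)%N%:Z = - Q%:Z + - l%:Z by lia.
by apply: ldegM; [apply: ldegN | apply: ldegV].
Qed.

(** A nonconstant [a n] shows that the expansion has not stopped at [n], so
    [phi n = - phi n.-1 / alpha n] gains the degree of [a n]. *)
Lemma cf_large_quotient n : (0 < n)%N -> (0 < (size (a n)).-1)%N -> exists Q : nat,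
  [/\ (n <= Q.+1)%N, size (q n) = Q.+1, size (p n) = (Q + e).+1,
      lead_coef (p n) = lead_coef (q n) * lcoef f e &
      lbd (- (Q + (size (a n)).-1)%N%:Z) (phi n)].
Proof.
case: n => // n _ san.
have an0 : alpha n.+1 != 0.
  by apply: contraTneq san => an0; rewrite /cf_quot an0 lfloor0 size_poly0.
have [Q [nQ [sq sp] _ lpq [phiE phiQ]]] := cf_invariant an0.
have [l [l0 al sal]] := cf_alphaS_deg an0.
exists Q; split=> //; rewrite sal /=.
have -> : phi n.+1 = - phi n * (alpha n.+1)^-1 by rewrite -phiE mulfK.
have -> : - (Q + l)%N%:Z = - Q%:Z + - l%:Z by lia.
by have [] := ldegM (ldegN phiQ) (ldegV al).
Qed.

Hypothesis f_irr : forall P Q, polyL P = polyL Q * f -> Q = 0.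

(** Stopping would make an error vanish with nonzero denominator, hence make [f] rational. *)
Lemma cf_alpha_neq0 n : alpha n != 0.
Proof.
elim: n => [|n IH]; first exact: ldeg_neq0 f_deg.
rewrite /= invr_eq0; case: n IH => [_|n IH].
  apply/negP; rewrite subr_eq0 => /eqP E.
  have := @f_irr (a 0) 1; rewrite rmorph1 mul1r => /(_ (esym E))/eqP.
  by rewrite oner_eq0.
apply/negP => E.
have [Q [nQ [sq sp] [sq' sp'] lpq [phiE phiQ]]] := cf_invariant IH.
have [l [l0 al sal]] := cf_alphaS_deg IH.
have a0 : a n.+1 != 0 by rewrite -size_poly_eq0 sal.
have q0 : q n.+1 != 0 by rewrite -size_poly_eq0 sq.
have saq : size (a n.+1 * q n.+1) = (l + Q).+1 by rewrite size_mul // sal sq addnS.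
have ltq : (size (q n) < size (a n.+1 * q n.+1)%R)%N by rewrite saq; lia.
have : phi n.+2 = 0.
  rewrite cf_errSS -[phi n]opprK -phiE.
  by move: E; rewrite subr_eq0 => /eqP E; rewrite -[polyL (a n.+1)]E mulrC subrr.
move=> /eqP; rewrite subr_eq0 => /eqP /f_irr /eqP.
by rewrite -size_poly_eq0 cf_denSS size_polyDl // saq.
Qed.

(** For the last [n] with [deg q n.+1 <= deg Q], the polynomial [P q n.+1 - Q p n.+1] has negative
    degree as a series, so it is 0. Coprimality of both pairs then makes them proportional. *)
Theorem legendre_criterion P Q : coprimep P Q -> Q != 0 ->
  lbd (- (size Q)%:Z) (polyL P - polyL Q * f) -> is_convergent f P Q.
Proof.
move=> cPQ Q0 PQ.
have inv n := cf_invariant (cf_alpha_neq0 n.+1).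
have ex : exists n, (size (q n.+1) <= size Q)%N.
  by exists 0%N; rewrite /= size_poly1 size_poly_gt0.
have bnd n : (size (q n.+1) <= size Q)%N -> (n <= size Q)%N.
  have [R [nR [-> _] _ _ _]] := inv n => lt.
  by apply: leq_trans nR (ltnW lt).
case: (ex_maxnP ex bnd) => n qn nmax.
have lt : (size Q < size (q n.+2))%N.
  by rewrite ltnNge; apply/negP => /nmax; rewrite ltnn.
have [R [nR [sq _] _ _ [_ phiR]]] := inv n.+1.
have E : P * q n.+1 = Q * p n.+1.
  apply/eqP; rewrite -subr_eq0 -size_poly_eq0 -leqn0.
  have : lbd (-1) (polyL (P * q n.+1 - Q * p n.+1)).
    have -> : polyL (P * q n.+1 - Q * p n.+1) =
        (polyL P - polyL Q * f) * polyL (q n.+1) - polyL Q * phi n.+1.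
      by rewrite /cf_err !rmorphB !rmorphM /=; ring.
    apply: lbdB.
      by apply: lbdW (lbdM PQ (@lbd_polyL _ _)); move: qn; move: (size _) (size _) => u v; lia.
    apply: lbdW (lbdM (@lbd_polyL _ Q) phiR.2).
    by move: lt; rewrite sq; move: (size Q) => u; lia.
  move=> /lbd_polyL_size; rewrite addNr maxxx; move: (size _) => u; lia.
have cpq := cf_coprime n.+1.
have /eqpP[[c1 c2] /= /andP[c10 c20] cE] : Q %= q n.+1.
  apply/andP; split.
    have cQP : coprimep Q P by rewrite coprimep_sym.
    by rewrite -(Gauss_dvdpr _ cQP) E dvdp_mulr.
  have cqp : coprimep (q n.+1) (p n.+1) by rewrite coprimep_sym.
  by rewrite -(Gauss_dvdpl _ cqp) -E dvdp_mull.
have q0 : q n.+1 != 0.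
  by have [R' [_ [s _] _ _ _]] := inv n; rewrite -size_poly_eq0 s.
have QE : Q = (c1^-1 * c2) *: q n.+1.
  by rewrite -scalerA -cE scalerA mulVf // scale1r.
exists n.+1, (c1^-1 * c2); first by rewrite mulf_neq0 // invr_eq0.
split=> //; apply: (mulIf q0).
by rewrite E QE -!scalerAl (mulrC (q n.+1)).
Qed.

End Convergents.

(** * The substitution t = (x + 1/x)/2 *)

Section Joukowski.
Variable K : numFieldType.

(** Identities involving [1/x] can thus be verified pointwise, away from 0. *)
Lemma poly_eq_nonzero (p q : {poly K}) : (forall x, x != 0 -> p.[x] = q.[x]) -> p = q.
Proof.
move=> pq; apply/eqP; rewrite -subr_eq0; apply/eqP.
apply: (@roots_geq_poly_eq0 _ _ [seq i.+1%:R | i <- iota 0 (size (p - q))]).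
- apply/allP => _ /mapP[i _ ->]; apply/rootP.
  by rewrite hornerD hornerN pq ?subrr // pnatr_eq0.
- rewrite map_inj_uniq ?iota_uniq // => i j /eqP.
  by rewrite eqr_nat => /eqP[].
by rewrite size_map size_iota.
Qed.

Definition jt (x : K) : K := (x + x^-1) / 2%:R.

(* x^m p((x + 1/x)/2) as a polynomial in x, for p of degree at most m *)
Definition joukowski m (p : {poly K}) : {poly K} :=
  \sum_(j < m.+1) (p`_j / 2%:R ^+ j) *: (('X^2 + 1) ^+ j * 'X^(m - j)).

Lemma horner_joukowski m (p : {poly K}) x : x != 0 -> (size p <= m.+1)%N ->
  (joukowski m p).[x] = x ^+ m * p.[jt x].
Proof.
move=> x0 sp; rewrite horner_sum (horner_coef_wide _ sp) mulr_sumr.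
apply: eq_bigr => j _; have jm : (j <= m)%N := ltn_ord j.
rewrite hornerZ hornerM horner_exp hornerD !hornerXn hornerC.
have -> : x ^+ 2 + 1 = x * (x + x^-1) by field.
have -> : x ^+ m = x ^+ j * x ^+ (m - j) by rewrite -exprD subnKC.
by rewrite /jt !exprMn exprVn; ring.
Qed.

Lemma size_X2D1_exp j : size (('X^2 + 1 : {poly K}) ^+ j) = (2 * j).+1.
Proof.
have s : size ('X^2 + 1 : {poly K}) = 3 by rewrite size_polyDl ?size_polyXn ?size_poly1.
have n0 : ('X^2 + 1 : {poly K}) ^+ j != 0 by rewrite expf_neq0 // -size_poly_eq0 s.
by rewrite -[LHS]prednK ?size_poly_gt0 // size_exp s.
Qed.

Lemma size_joukowski_term m j : (j <= m)%N ->
  size (('X^2 + 1 : {poly K}) ^+ j * 'X^(m - j)) = (m + j).+1.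
Proof.
move=> jm; have n0 : ('X^2 + 1 : {poly K}) ^+ j != 0 by rewrite -size_poly_eq0 size_X2D1_exp.
by rewrite size_mulXn // size_X2D1_exp; lia.
Qed.

Lemma size_joukowski m p : (size (joukowski m p) <= (2 * m).+1)%N.
Proof.
apply: leq_trans (size_sum _ _ _) _; apply/bigmax_leqP => j _.
apply: leq_trans (size_scale_leq _ _) _; have jm : (j <= m)%N := ltn_ord j.
by rewrite size_joukowski_term //; lia.
Qed.

Lemma coef_joukowski_top m p : (joukowski m p)`_(2 * m) = p`_m / 2%:R ^+ m.
Proof.
rewrite /joukowski big_ord_recr /= coefD coef_sum big1 ?add0r => [|j _].
  rewrite coefZ subnn mulr1.
  have -> : (2 * m)%N = (size (('X^2 + 1 : {poly K}) ^+ m)).-1 by rewrite size_X2D1_exp.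
  rewrite -lead_coefE lead_coef_exp lead_coefDl ?size_polyXn ?size_poly1 //.
  by rewrite lead_coefXn expr1n mulr1.
have jm := ltn_ord j.
by rewrite coefZ [X in _ * X]nth_default ?mulr0 // size_joukowski_term; lia.
Qed.

(** Write [J] and [I] for [x^(k+1)] times the two parts. The product [(J - I)(J + I)] is [x^(2k+2)]
    times the norm at [t], of degree at most [2k + 2 + deg N]; since [J + I] has degree at least
    [2k + 2], [P = J - I] has degree at most [deg N]. *)
Theorem norm_factor k (p u : {poly K}) :
  (size p <= k.+2)%N -> (size u <= k.+1)%N -> p`_k.+1 + u`_k != 0 ->
  exists P : {poly K}, [/\ P != 0, (size P <= size (p ^+ 2 - ('X^2 - 1) * u ^+ 2)%R)%N &
    forall x, x != 0 -> P.[x] = x ^+ k.+1 * (p.[jt x] - u.[jt x] * ((x - x^-1) / 2%:R))].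
Proof.
move=> sp su lead; set N := p ^+ 2 - _.
pose J := joukowski k.+1 p; pose I := 2%:R^-1 *: (('X^2 - 1) * joukowski k u).
have IE x : x != 0 -> I.[x] = x ^+ k.+1 * (u.[jt x] * ((x - x^-1) / 2%:R)).
  move=> x0; rewrite hornerZ hornerM hornerD hornerN hornerXn hornerC horner_joukowski //.
  have -> : x ^+ 2 - 1 = x * (x - x^-1) by field.
  by rewrite exprS; ring.
have JE x : x != 0 -> J.[x] = x ^+ k.+1 * p.[jt x] by move=> x0; apply: horner_joukowski.
have twice (t : {poly K}) n : (size t <= n.+1)%N -> (size (t ^+ 2)%R <= (2 * n).+1)%N.
  move=> st; rewrite expr2; apply: leq_trans (size_polyMleq _ _) _; lia.
have sN : (size N <= (2 * k.+1).+1)%N.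
  apply: leq_trans (size_polyD _ _) _; rewrite size_polyN geq_max twice //=.
  have s3 : size ('X^2 - 1 : {poly K}) = 3.
    by rewrite size_polyDl size_polyXn // size_polyN size_poly1.
  apply: leq_trans (size_polyMleq _ _) _; rewrite s3; have := twice _ _ su; lia.
have top : (J + I)`_(2 * k.+1) = (p`_k.+1 + u`_k) / 2%:R ^+ k.+1.
  rewrite coefD coef_joukowski_top coefZ mulrBl mul1r coefB coefXnM.
  have e1 : (2 * k.+1 < 2)%N = false by lia.
  have e2 : (2 * k.+1 - 2 = 2 * k)%N by lia.
  rewrite {}e1 {}e2.
  have e3 : (joukowski k u)`_(2 * k.+1) = 0.
    by apply: nth_default; apply: leq_trans (size_joukowski _ _) _; lia.
  rewrite coef_joukowski_top e3 subr0.
  by rewrite exprS invfM; ring.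
have top0 : (J + I)`_(2 * k.+1) != 0.
  by rewrite top mulf_neq0 // invr_eq0 expf_neq0 // pnatr_eq0.
have JI0 : J + I != 0 by apply: contraNneq top0 => ->; rewrite coef0.
have sJI : (2 * k.+1 < size (J + I)%R)%N.
  by rewrite ltnNge; apply: contraNN top0 => le; rewrite nth_default.
(* Inversion exchanges [J - I] and [J + I] up to a power of [x], so [J - I] is nonzero too. *)
have refl x : x != 0 -> (J + I).[x] = x ^+ (2 * k.+1) * (J - I).[x^-1].
  move=> x0; have xV0 : x^-1 != 0 by rewrite invr_eq0.
  have jtV : jt x^-1 = jt x by rewrite /jt invrK addrC.
  rewrite !hornerD hornerN IE // JE // IE // JE // jtV invrK mul2n -addnn exprD exprVn.
  have xk : x ^+ k.+1 != 0 by rewrite expf_neq0.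
  move: (x ^+ k.+1) xk => c c0; field.
  by rewrite c0 x0.
have JmI0 : J - I != 0.
  apply: contraNneq JI0 => E; apply/eqP/poly_eq_nonzero => x x0.
  by rewrite refl // E !horner0 mulr0.
have prodE : (J - I) * (J + I) = 'X^(2 * k.+1 - (size N).-1) * joukowski (size N).-1 N.
  apply: poly_eq_nonzero => x x0.
  have NE : N.[jt x] = p.[jt x] ^+ 2 - (jt x ^+ 2 - 1) * u.[jt x] ^+ 2.
    by rewrite /N hornerD hornerN horner_exp hornerM horner_exp hornerD hornerN hornerXn hornerC.
  rewrite !hornerM hornerXn horner_joukowski ?leqSpred // NE.
  have -> : (J - I).[x] = J.[x] - I.[x] by rewrite hornerD hornerN.
  have -> : (J + I).[x] = J.[x] + I.[x] by rewrite hornerD.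
  rewrite IE // JE // [RHS]mulrA -exprD subnK; last by move: sN; move: (size N) => v; lia.
  rewrite mul2n -addnn exprD /jt; move: (p.[_]) (u.[_]) (x ^+ k.+1) => a b c.
  by field.
have N0 : N != 0.
  have : (J - I) * (J + I) != 0 by rewrite mulf_neq0.
  apply: contraNneq => N0; rewrite prodE N0 size_poly0 /= /joukowski big_ord1.
  by rewrite coef0 mul0r scale0r mulr0.
exists (J - I); split=> //; last first.
  by move=> x x0; rewrite hornerD hornerN IE // JE // mulrBr.
have sN0 : (0 < size N)%N by rewrite size_poly_gt0.
have sprod : size ((J - I) * (J + I)) = (size (J - I) + size (J + I)%R).-1.
  by rewrite size_mul.
have sjN := size_joukowski (size N).-1 N.
have le := size_polyMleq 'X^(2 * k.+1 - (size N).-1) (joukowski (size N).-1 N).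
rewrite size_polyXn -prodE sprod in le.
move: le sjN sN0 sN sJI; move: (size N) (size (J - I)) (size (J + I)) (size (joukowski _ _)).
by move=> v w y z; clear; lia.
Qed.

End Joukowski.

(** * Convergents of the square root of (t^2 - 1) A^2 *)

Section SquareRoots.
Variable K : numFieldType.

Lemma two_neq0 : 2 != 0 :> K. Proof. by rewrite pnatr_eq0. Qed.

Lemma size_X2B1 : size ('X^2 - 1 : {poly K}) = 3.
Proof. by rewrite size_polyDl size_polyXn // size_polyN size_poly1. Qed.

Lemma X2B1_monic : ('X^2 - 1 : {poly K}) \is monic.
Proof.
by apply/monicP; rewrite lead_coefDl ?lead_coefXn // size_polyN size_poly1 size_polyXn.
Qed.

Definition pell_poly (A : {poly K}) : {poly K} := ('X^2 - 1) * A ^+ 2.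

Lemma pell_poly_monic A : A \is monic -> pell_poly A \is monic.
Proof. by move=> mA; rewrite rpredM ?rpredX ?X2B1_monic. Qed.

Lemma size_pell_poly A g : A \is monic -> size A = g.+1 ->
  size (pell_poly A) = (g.+1 + g.+1).+1.
Proof.
move=> mA sA; have A0 : A != 0 by apply: monic_neq0.
rewrite /pell_poly size_monicM ?X2B1_monic ?expf_neq0 // size_X2B1 expr2.
by rewrite size_mul // sA; lia.
Qed.

Lemma lsqrt_spec (E : {poly K}) e : E \is monic -> size E = (e + e).+1 ->
  [/\ lsqrt E ^+ 2 = polyL E, ldeg (lsqrt E) e%:Z & lcoef (lsqrt E) e%:Z = 1].
Proof.
move=> mE sE; have eE : (size E).-1./2 = e by rewrite sE /= addnn doubleK.
have oE : ~~ odd (size E).-1 by rewrite sE /= addnn odd_double.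
have [sq s1 sb] := lsqrtP two_neq0 mE oE.
rewrite eE in s1 sb; split=> //; split=> //.
by rewrite s1 oner_neq0.
Qed.

Lemma lsqrt_eq (E : {poly K}) e f : E \is monic -> size E = (e + e).+1 ->
  f ^+ 2 = polyL E -> lbd e%:Z f -> lcoef f e%:Z = 1 -> lsqrt E = f.
Proof.
move=> mE sE fE fe f1; have eE : (size E).-1./2 = e by rewrite sE /= addnn doubleK.
have oE : ~~ odd (size E).-1 by rewrite sE /= addnn odd_double.
apply: (is_lsqrt_unique two_neq0 (lsqrtP two_neq0 mE oE)).
by split; rewrite ?eE.
Qed.

(** Descent at the simple root 1 of [t^2 - 1]: [X - 1] divides [p], hence [w], and can be
    cancelled. *)
Lemma X2B1_not_square (p w : {poly K}) : p ^+ 2 = w ^+ 2 * ('X^2 - 1) -> w = 0.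
Proof.
have [n] := ubnP (size w); elim: n p w => // n IH p w; rewrite ltnS => sw E.
have fact : 'X^2 - 1 = ('X - 1%:P) * ('X + 1) :> {poly K} by rewrite polyC1; ring.
have X1 : 'X - 1%:P != 0 :> {poly K} by rewrite polyXsubC_eq0.
have [p1 pE] : exists p1, p = p1 * ('X - 1%:P).
  apply/factor_theorem/rootP/eqP; rewrite -[_ == 0]orbb -mulf_eq0 -hornerM -expr2 E.
  by rewrite fact !hornerM hornerXsubC subrr mul0r mulr0.
have E1 : p1 ^+ 2 * ('X - 1%:P) = w ^+ 2 * ('X + 1).
  by apply: (mulIf X1); rewrite -mulrA -expr2 -exprMn -pE E fact; ring.
have [w1 wE] : exists w1, w = w1 * ('X - 1%:P).
  apply/factor_theorem/rootP/eqP.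
  have := congr1 (horner^~ 1) E1; rewrite !hornerM hornerXsubC subrr mulr0 => /esym/eqP.
  rewrite hornerD hornerX hornerC -[1 + 1]/(2%:R) !mulf_eq0 (negPf two_neq0) orbF.
  by rewrite orbb.
have [w10|w10] := eqVneq w1 0; first by rewrite wE w10 mul0r.
suff w0 : w1 = 0 by rewrite wE w0 mul0r.
apply: (IH p1).
  apply: leq_trans sw; rewrite wE size_mul // size_XsubC addn2 //.
by apply: (mulIf X1); rewrite E1 wE fact; ring.
Qed.

Lemma pell_irrational (A P Q : {poly K}) : A \is monic ->
  polyL P = polyL Q * lsqrt (pell_poly A) -> Q = 0.
Proof.
move=> mA E; have A0 : A != 0 := monic_neq0 mA.
have sA : size A = (size A).-1.+1 by rewrite prednK // size_poly_gt0.
have [sq _ _] := lsqrt_spec (pell_poly_monic mA) (size_pell_poly mA sA).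
have /eqP : Q * A = 0.
  apply: (@X2B1_not_square P); apply: polyL_inj.
  rewrite rmorphXn /= E exprMn sq -rmorphXn -rmorphM /pell_poly; congr polyL; ring.
by rewrite mulf_eq0 (negPf A0) orbF => /eqP.
Qed.

Section Solution.
Variables (g : nat) (A : {poly K}).
Hypotheses (mA : A \is monic) (sA : size A = g.+1).
Local Notation f := (lsqrt (pell_poly A)).

(** [norm_factor] is applied to [p = cf_num f n] and [u = q A]. The norm is the error times
    [p + q f], of degree at most [g + 1 - l], and [u] disappears at the roots of [A]. *)
Lemma convergent_solution n : (0 < n)%N -> (0 < (size (cf_quot f n)).-1)%N ->
  exists m (P : {poly K}), [/\ (n <= m)%N, P != 0,
    (size P + (size (cf_quot f n)).-1 <= g.+2)%N &
    forall x, x != 0 -> root A (jt x) -> P.[x] = x ^+ m * (cf_num f n).[jt x]].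
Proof.
move=> n0; set l := (size _).-1 => l0.
have [sq fdeg f1] := lsqrt_spec (pell_poly_monic mA) (size_pell_poly mA sA).
have [Q [nQ sqn spn lpq]] := cf_large_quotient fdeg (ltn0Sn g) n0 l0.
rewrite -/l f1 mulr1 in lpq * => phiQ.
set p := cf_num f n in spn lpq phiQ *; set q := cf_den f n in sqn lpq phiQ *.
have q0 : q != 0 by rewrite -size_poly_eq0 sqn.
have A0 : A != 0 := monic_neq0 mA.
have su : size (q * A) = (Q + g).+1 by rewrite size_mul // sqn sA; lia.
have [] := @norm_factor K (Q + g) p (q * A).
- by rewrite spn addnS.
- by rewrite su.
(* As [f] has leading coefficient 1, [p] and [q A] have equal leading coefficients and the sum is
   twice that value. *)
- have -> : p`_(Q + g).+1 = lead_coef p by rewrite lead_coefE spn addnS.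
  have -> : (q * A)`_(Q + g) = lead_coef q.
    by rewrite -[(Q + g)%N]/((Q + g).+1.-1) -su -lead_coefE lead_coefM (monicP mA) mulr1.
  rewrite lpq -mulr2n -mulr_natr mulf_neq0 ?two_neq0 //.
  by rewrite lead_coef_eq0.
move=> P [P0 sP PE]; exists (Q + g).+1, P; split=> //.
- by lia.
- have : lbd (g.+1%:Z - l%:Z) (polyL (p ^+ 2 - ('X^2 - 1) * (q * A) ^+ 2)).
    have -> : polyL (p ^+ 2 - ('X^2 - 1) * (q * A) ^+ 2) =
        cf_err f n * (polyL p + polyL q * f).
      rewrite /cf_err -/p -/q.
      transitivity (polyL p ^+ 2 - polyL q ^+ 2 * f ^+ 2); last by ring.
      rewrite sq -!rmorphXn -rmorphM -rmorphB /pell_poly; congr polyL; ring.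
    have bp : lbd (Q + g.+1)%N%:Z (polyL p).
      by have := @lbd_polyL _ p; rewrite spn; apply: lbdW; lia.
    have bq : lbd Q%:Z (polyL q).
      by have := @lbd_polyL _ q; rewrite sqn; apply: lbdW; lia.
    have bqf : lbd (Q + g.+1)%N%:Z (polyL q * f) by rewrite PoszD; apply: lbdM fdeg.2.
    by apply: lbdW (lbdM phiQ (lbdD bp bqf)); lia.
  move=> /lbd_polyL_size.
  have : (0 < size P)%N by rewrite size_poly_gt0.
  by move: sP; set N := p ^+ 2 - _; move: (size P) (size N) => u v; lia.
by move=> x x0 rx; rewrite PE // hornerM (rootP rx) mulr0 mul0r subr0.
Qed.

End Solution.

(** Since [f = h B], the error of [f] is [B (p - q h)]. Dividing by [B] lowers its degree further,
    so Legendre's criterion applies to [h]. *)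
Lemma convergent_descent (A B : {poly K}) g s n : A \is monic -> B \is monic ->
  size A = g.+1 -> size B = s.+1 -> B %| A -> (0 < n)%N ->
  let f := lsqrt (pell_poly A) in let l := (size (cf_quot f n)).-1 in
  (0 < l)%N -> B %| cf_num f n ->
  exists p, is_convergent (lsqrt (pell_poly (A %/ B))) p (cf_den f n) /\
    cf_num f n = p * B.
Proof.
move=> mA mB sA sB BA n0 f l l0 Bp.
have A0 := monic_neq0 mA; have B0 := monic_neq0 mB.
pose A' := A %/ B; have AE : A = A' * B by rewrite /A' divpK.
have mA' : A' \is monic by rewrite -(monicMr _ mB) -AE.
have A'0 := monic_neq0 mA'.
have sA' : size A' = (size A').-1.+1 by rewrite prednK // size_poly_gt0.
have [sqf fdeg f1] := lsqrt_spec (pell_poly_monic mA) (size_pell_poly mA sA).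
pose h := lsqrt (pell_poly A').
have [sqh hdeg h1] := lsqrt_spec (pell_poly_monic mA') (size_pell_poly mA' sA').
have [Q [nQ sqn spn _ phiQ]] := cf_large_quotient fdeg (ltn0Sn g) n0 l0.
have gE : g = ((size A').-1 + s)%N.
  by have := size_mul A'0 B0; rewrite -AE sA sB sA' /= => /eqP; lia.
have fE : f = h * polyL B.
  have := lbdM hdeg.2 (ldeg_polyL sB).2; have := lcoefM_top hdeg.2 (ldeg_polyL sB).2.
  have -> : (size A').-1.+1%:Z + s%:Z = g.+1%:Z by rewrite gE; lia.
  rewrite h1 mul1r lcoef_polyL -[s]/(s.+1.-1) -sB -lead_coefE (monicP mB) => c1 cb.
  apply: lsqrt_eq (pell_poly_monic mA) (size_pell_poly mA sA) _ cb c1.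
  by rewrite exprMn sqh -rmorphXn -rmorphM AE /pell_poly; congr polyL; ring.
pose p := cf_num f n %/ B; have pE : cf_num f n = p * B by rewrite /p divpK.
exists p; split=> //.
apply: (legendre_criterion hdeg (ltn0Sn _)).
- by move=> P Q'; apply: pell_irrational.
- have := cf_coprime f n; rewrite pE coprimepMl => /andP[] //.
- by rewrite -size_poly_eq0 sqn.
have : lbd (- (Q + l)%N%:Z) (polyL B * (polyL p - polyL (cf_den f n) * h)).
  rewrite (_ : polyL B * _ = cf_err f n) // /cf_err pE fE rmorphM; ring.
move=> /(lbd_divM (ldeg_polyL sB)); apply: lbdW; rewrite sqn.
by move: l0; rewrite -/l; lia.
Qed.

End SquareRoots.

(** * Large partial quotients *)

Local Open Scope classical_set_scope.

Section LargeQuotients.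
Variables (K : numFieldType) (g : nat) (rho b : 'I_g -> K).
Hypotheses (rho_inj : injective rho) (b0 : forall i, b i != 0).
Hypothesis jt_b : forall i, jt (b i) = rho i.
Hypothesis b_uniq : uniq ([seq b i | i <- enum 'I_g] ++ [seq (b i)^-1 | i <- enum 'I_g]).

Let unity i := `[< is_root_of_unity (b i) >].
Let r := #|[pred i | unity i]|.
Let A : {poly K} := \prod_i ('X - (rho i)%:P).
Let B : {poly K} := \prod_(i | ~~ unity i) ('X - (rho i)%:P).
Local Notation f := (lsqrt (pell_poly A)).
Local Notation a := (cf_quot f).

Let b_inj : injective b.
Proof. by apply/injectiveP; move: b_uniq; rewrite cat_uniq => /and3P[]. Qed.

Let b_inv i j : b i != (b j)^-1.
Proof.
move: b_uniq; rewrite cat_uniq => /and3P[_ /hasPn H _].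
apply/eqP => e; have := H (b j)^-1 (map_f (fun i => (b i)^-1) (mem_enum _ j)).
by rewrite /= -e map_f ?mem_enum.
Qed.

Let A_monic : A \is monic.
Proof. exact: monic_prod_XsubC. Qed.

Let size_A : size A = g.+1.
Proof. by rewrite /A size_prod_XsubC /index_enum -enumT size_enum_ord. Qed.

Let B_monic : B \is monic.
Proof. exact: monic_prod_XsubC. Qed.

Let r_le : (r + #|[pred i | ~~ unity i]| = g)%N.
Proof.
rewrite -[RHS]card_ord -(cardC [pred i | unity i]); congr (_ + _)%N.
Qed.

Definition reflected m (P : {poly K}) := forall i, P.[b i] = b i ^+ (2 * m) * P.[(b i)^-1].

(** Both [b i] and its inverse lie over [rho i], so the values of [P] there are [b i ^+ m] and
    [b i ^- m] times the same number. *)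
Lemma quotient_solution n : (0 < n)%N -> (0 < (size (a n)).-1)%N ->
  exists m (P : {poly K}), [/\ (n <= m)%N, P != 0, (size P + (size (a n)).-1 <= g.+2)%N,
    reflected m P & forall i, P.[b i] = b i ^+ m * (cf_num f n).[rho i]].
Proof.
move=> n0 l0; have [m [P [nm P0 sP PE]]] := convergent_solution A_monic size_A n0 l0.
have rA i : root A (rho i).
  by rewrite /A (bigD1 i) //= rootM root_XsubC eqxx.
have jtV i : jt (b i)^-1 = rho i by rewrite /jt invrK addrC -/(jt _) jt_b.
exists m, P; split=> // i; last by rewrite PE ?jt_b ?rA.
have bV0 : (b i)^-1 != 0 by rewrite invr_eq0.
rewrite !PE ?jt_b ?jtV ?rA // mulrA mul2n -addnn exprD exprVn mulfK //.
by rewrite expf_neq0.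
Qed.

(** Here [size P <= (g + 2) - (r + 2) = g - r], the number of nodes of infinite order; the twisted
    system forces [P = 0] once [n], and with it [m >= n], is large. *)
Lemma finite_large_quotients : finite_set [set n : nat | (r + 2 <= (size (a n)).-1)%N].
Proof.
pose I := [pred i | ~~ unity i].
pose c (i : 'I_#|I|) := b (enum_val i).
have c0 i : c i != 0 by apply: b0.
have c_inj : injective c by move=> i j /b_inj /enum_val_inj.
have c_inv i j : c i != (c j)^-1 by apply: b_inv.
have c_nt i : ~ is_root_of_unity (c i).
  by apply/asboolPn; have := enum_valP i; rewrite inE.
have [N NP] := twisted_system_trivial c0 c_inj c_inv c_nt.
apply: (@sub_finite_set _ _ `I_N.+1); last exact: finite_II.
move=> n /= ln; rewrite ltnNge; apply/negP => Nn.
have n0 : (0 < n)%N by apply: leq_trans Nn.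
have l0 : (0 < (size (a n)).-1)%N by apply: leq_trans ln; rewrite addnS.
have [m [P [nm /eqP P0 sP PE _]]] := quotient_solution n0 l0.
apply: P0; apply: (NP m).
- by apply: leq_trans nm; apply: ltnW.
- by move: r_le ln sP; rewrite -/I; move: (size (a n)) (size P) => u v; lia.
- by move=> i; apply: PE.
Qed.

Let unity_order : exists2 T, (0 < T)%N & forall i, unity i -> b i ^+ T = 1.
Proof.
have /choice[k kP] : forall i, exists k, (0 < k)%N /\ (unity i -> b i ^+ k = 1).
  move=> i; have [ui|nu] := boolP (unity i); last by exists 1%N.
  by have /asboolP[k k0 kE] := ui; exists k.
exists (\prod_i k i)%N; first by rewrite prodn_gt0 // => i; apply: (kP i).1.
by move=> i ui; rewrite (bigD1 i) //= exprM (kP i).2 // expr1n.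
Qed.

Definition solvable_at i m := exists P : {poly K},
  [/\ (size P <= r.+1)%N, reflected m P & P.[b i] != 0].

(** The equations at the roots of unity are the same for [m] and [m'] and fix the ratio of [P] at
    [b i] and its inverse. Hence [b i ^+ (2 * m) = b i ^+ (2 * m')], and [b i] has infinite
    order. *)
Lemma solvable_at_unique T i m m' : (forall j, unity j -> b j ^+ T = 1) ->
  ~~ unity i -> solvable_at i m -> solvable_at i m' -> (m = m' %[mod T])%N -> m = m'.
Proof.
move=> bT nui; wlog le : m m' / (m <= m')%N.
  by move=> W; case: (leqP m m') => [/W//|/ltnW/W H x y e]; rewrite (H y x).
move=> [P [sP PE Pi]] [P' [sP' PE' Pi']] mm.
pose bs := [seq b j | j <- enum [pred j | unity j]].
have sbs : size bs = r by rewrite size_map -cardE.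
have ubs : uniq (bs ++ [seq x^-1 | x <- bs]).
  rewrite cat_uniq; apply/and3P; split.
  - by rewrite map_inj_uniq ?enum_uniq.
  - apply/hasPn => _ /mapP[_ /mapP[j _ ->] ->]; apply/negP => /mapP[k _ /eqP].
    by rewrite eq_sym (negPf (b_inv _ _)).
  - by rewrite -map_comp map_inj_uniq ?enum_uniq // => x y /= /invr_inj /b_inj.
have bs0 : 0 \notin bs by apply/mapP => -[j _ /esym/eqP]; rewrite (negPf (b0 _)).
have bmod j : unity j -> b j ^+ (2 * m) = b j ^+ (2 * m').
  move=> /bT uj; suff H k : b j ^+ k = b j ^+ (k %% T).
    by rewrite !(mulnC 2) !exprM (H m) (H m') mm.
  by rewrite {1}(divn_eq k T) exprD mulnC exprM uj expr1n mul1r.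
have E : P.[b i] * P'.[(b i)^-1] = P.[(b i)^-1] * P'.[b i].
  apply: (@reflection_proportional _ bs (fun x => x ^+ (2 * m)) P P' ubs bs0);
    rewrite ?sbs // => _ /mapP[j uj ->]; first exact: PE.
  have uj' : unity j by move: uj; rewrite mem_enum.
  by rewrite (bmod _ uj'); apply: PE'.
have PV : P.[(b i)^-1] != 0 by apply: contraNneq Pi => e; rewrite PE e mulr0.
have PV' : P'.[(b i)^-1] != 0 by apply: contraNneq Pi' => e; rewrite PE' e mulr0.
have Ebm : b i ^+ (2 * m) = b i ^+ (2 * m').
  apply: (mulIf (mulf_neq0 PV PV')); rewrite mulrA -PE E PE'; ring.
apply/eqP; rewrite eqn_leq le leqNgt; apply/negP => lt.
move/asboolPn: nui; apply; exists (2 * (m' - m))%N; first by rewrite muln_gt0 subn_gt0.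
have bm : b i ^+ (2 * m) != 0 by rewrite expf_neq0.
apply: (mulfI bm); rewrite -exprD mulr1 -mulnDr subnKC //.
Qed.

(** Each pair of an index and a residue modulo [T] admits at most one [m]. *)
Lemma bounded_solvable : exists N, forall i m, ~~ unity i -> solvable_at i m -> (m <= N)%N.
Proof.
have [T T0 bT] := unity_order.
have /choice[N NP] : forall ic : 'I_g * 'I_T, exists N, forall m,
    ~~ unity ic.1 -> solvable_at ic.1 m -> (m %% T = ic.2)%N -> (m <= N)%N.
  move=> [i c] /=; have [[m0 [nu s0 c0]]|no] := pselect (exists m0,
    [/\ ~~ unity i, solvable_at i m0 & (m0 %% T = c)%N]).
    exists m0 => m _ sm mc; rewrite (solvable_at_unique bT nu sm s0) //.
    by rewrite mc c0.
  by exists 0%N => m nu sm mc; exfalso; apply: no; exists m.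
exists (\max_ic N ic)%N => i m nu sm.
have mT : (m %% T < T)%N by rewrite ltn_mod.
by apply: leq_trans (leq_bigmax (i, Ordinal mT)); apply: NP.
Qed.

Lemma finite_exceptional_quotients :
  finite_set [set n : nat | (g.+1 - r <= (size (a n)).-1)%N /\
    ~ (exists p q : {poly K},
         [/\ is_convergent (lsqrt (('X^2 - 1) * \prod_(i | unity i) ('X - (rho i)%:P) ^+ 2)) p q,
             cf_num f n = p * B & cf_den f n = q])].
Proof.
have [N NP] := bounded_solvable.
have AE : A = \prod_(i | unity i) ('X - (rho i)%:P) * B by rewrite /A (bigID unity).
have DpE : ('X^2 - 1) * \prod_(i | unity i) ('X - (rho i)%:P) ^+ 2 = pell_poly (A %/ B) :> {poly K}.
  by rewrite /pell_poly AE mulpK ?monic_neq0 // prodrXl.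
apply: (@sub_finite_set _ _ `I_N.+1); last exact: finite_II.
move=> n /= [ln nex]; rewrite ltnS; case: (posnP n) => [->//|n0].
have l0 : (0 < (size (a n)).-1)%N 
  by apply: leq_trans ln; rewrite subn_gt0 ltnS -r_le leq_addr.
have [m [P [nm P0 sP PE Pp]]] := quotient_solution n0 l0.
apply: (leq_trans nm).
(* Otherwise [B] divides the numerator and the descent to [Dp] puts [n] among the excluded
   indices. *)
have [i nui pi] : exists2 i, ~~ unity i & (cf_num f n).[rho i] != 0.
  apply: contrapT => no; apply: nex; rewrite DpE.
  have BE : B = \prod_(z <- [seq rho i | i <- enum [pred i | ~~ unity i]]) ('X - z%:P).
    by rewrite big_map big_enum.
  have sB : size B = #|[pred i | ~~ unity i]|.+1.
    by rewrite BE size_prod_XsubC size_map -cardE.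
  have BA : B %| A by rewrite AE dvdp_mull.
  have [||q qE] := @uniq_roots_prod_XsubC _ (cf_num f n)
      [seq rho i | i <- enum [pred i | ~~ unity i]].
  - apply/allP => _ /mapP[i iI ->]; have nui : ~~ unity i by move: iI; rewrite mem_enum.
    by apply/rootP/eqP/negPn/negP => pi0; apply: no; exists i.
  - by rewrite uniq_rootsE map_inj_uniq ?enum_uniq.
  have Bp : B %| cf_num f n by rewrite qE BE dvdp_mull.
  have [p [pc pE]] := convergent_descent A_monic B_monic size_A sB BA n0 l0 Bp.
  by exists p, (cf_den f n).
apply: (NP i) => //; exists P; split=> //.
  (* With [r <= g] the subtraction [g.+1 - r] is not truncated, which gives [size P <= r + 1]. *)
  have rg : (r <= g)%N by rewrite -r_le leq_addr.
  by move: ln sP rg; move: (size (a n)) (size P) r => u v w; lia.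
by rewrite Pp mulf_neq0 // expf_neq0.
Qed.

End LargeQuotients.

Local Open Scope complex_scope.

Theorem mainTheorem1 (R : realType) (g : nat) (rho s : 'I_g -> R[i])
    (g_ge1 : (1 <= g)%N)
    (rho_inj : injective rho)
    (rho_neq : forall i, rho i != 1 /\ rho i != -1)
    (s_sqrt : forall i, s i ^+ 2 = rho i ^+ 2 - 1) :
  let b := fun i => rho i + s i in
  let D1 : {poly R[i]} := \prod_i ('X - (rho i)%:P) in
  let D : {poly R[i]} := ('X^2 - 1) * D1 ^+ 2 in
  let d := g.+1 in
  let unity := fun i => `[< is_root_of_unity (b i) >] in
  let r := #|[pred i | unity i]| in
  let Dp : {poly R[i]} :=
    ('X^2 - 1) * \prod_(i | unity i) ('X - (rho i)%:P) ^+ 2 in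
  let a := cf_quot (lsqrt D) in
  uniq ([seq b i | i <- enum 'I_g] ++ [seq (b i)^-1 | i <- enum 'I_g]) ->
  finite_set [set n : nat | (r + 2 <= (size (a n)).-1)%N] /\
  finite_set [set n : nat | (d - r <= (size (a n)).-1)%N /\
    ~ (exists p q : {poly R[i]},
         [/\ is_convergent (lsqrt Dp) p q,
             cf_num (lsqrt D) n = p * \prod_(i | ~~ unity i) ('X - (rho i)%:P) &
             cf_den (lsqrt D) n = q])].
Proof.
move=> b D1 D d unity r Dp a b_uniq.
(* The inverse of [b i] is [rho i - s i], so the mean of [b i] and its inverse is [rho i]. *)
have bV i : b i * (rho i - s i) = 1.
  by rewrite /b -[LHS]/((rho i + s i) * (rho i - s i)) mulrC -subr_sqr s_sqrt; ring.
have b0 i : b i != 0.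
  by apply: contraTneq (oner_neq0 R[i]) => bi0; rewrite -(bV i) bi0 mul0r eqxx.
have jt_b i : jt (b i) = rho i.
  have -> : jt (b i) = (b i + (rho i - s i)) / 2%:R.
    by rewrite /jt -[(b i)^-1]mulr1 -(bV i) mulKf.
  by rewrite /b; field.
split.
  exact: (finite_large_quotients b0 jt_b b_uniq).
exact: (finite_exceptional_quotients rho_inj b0 jt_b b_uniq).
Qed.
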